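(* Let $R$ be a commutative Noetherian domain of Krull dimension $d$ and $I$ an ideal of $R$. (1) If $P$ is a finitely generated projective module over the Rees algebra $R[It]$ of rank $>d$, then $P$ has a unimodular element. (2) If $Q$ is a finitely generated projective module over the extended Rees algebra $R[It,t^{-1}]$ of rank $>d$, then $Q$ has a unimodular element.
   Context: For an ideal $I$ of $R$ and an indeterminate $t$, the Rees algebra is $R[It]=\bigoplus_{n\geq 0} I^n t^n\subset R[t]$, and the extended Rees algebra is $R[It,t^{-1}]=\bigoplus_{n\in\mathbb{Z}} I^n t^n\subset R[t,t^{-1}]$, where $I^n=R$ for $n\leq 0$. For a module $Q$ over a ring $A$, an element $p\in Q$ is unimodular if $\{\phi(p):\phi\in\mathrm{Hom}_A(Q,A)\}=A$; equivalently $Q\cong Q'\oplus A$ with $p$ corresponding to a basis of the summand $A$ (for projective $Q$). *)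

(* Defs.v *)
From HB Require Import structures.
From mathcomp Require Import all_boot all_order all_algebra.
Set Implicit Arguments. Unset Strict Implicit. Unset Printing Implicit Defensive.
Import Order.TTheory GRing.Theory Num.Theory.
Local Open Scope ring_scope.

Definition is_ideal (R : comNzRingType) (J : R -> Prop) : Prop :=
  [/\ J 0, (forall x y, J x -> J y -> J (x + y)) & (forall r x, J x -> J (r * x))].

Definition is_prime_ideal (R : comNzRingType) (J : R -> Prop) : Prop :=
  [/\ is_ideal J, ~ J 1 & (forall a b, J (a * b) -> J a \/ J b)].

Definition noetherian (R : comNzRingType) : Prop :=
  forall J : nat -> R -> Prop, (forall n, is_ideal (J n)) ->
    (forall n x, J n x -> J n.+1 x) ->
    exists N, forall n, (N <= n)%N -> forall x, J n x -> J N x.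

Definition prime_chain (R : comNzRingType) (n : nat) (c : nat -> R -> Prop) : Prop :=
  (forall i, (i <= n)%N -> is_prime_ideal (c i)) /\
  (forall i, (i < n)%N -> (forall x, c i x -> c i.+1 x) /\ exists x, c i.+1 x /\ ~ c i x).

Definition krull_dim (R : comNzRingType) (d : nat) : Prop :=
  (exists c, prime_chain (R := R) d c) /\ ~ (exists c, prime_chain (R := R) d.+1 c).

Fixpoint ipow (R : comNzRingType) (I : R -> Prop) (n : nat) : R -> Prop :=
  match n with
  | 0 => fun _ => True
  | n'.+1 => fun x => exists s : seq (R * R),
      (forall q, q \in s -> I q.1 /\ ipow I n' q.2) /\ x = \sum_(q <- s) q.1 * q.2
  end.

Definition rees_set (R : comNzRingType) (I : R -> Prop) (p : {poly R}) : Prop :=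
  forall i, ipow I i p`_i.

(* The extended Rees algebra R[It,t^-1] as a subset of R[t,t^-1], itself
   viewed inside the fraction field of R[t]: elements p / t^n with the
   coefficient of t^(i-n) in I^(i-n) (I^k = R for k <= 0). *)
Definition ext_rees_set (R : idomainType) (I : R -> Prop)
    (x : {fraction {poly R}}) : Prop :=
  exists (n : nat) (p : {poly R}),
    x = FracField.tofrac p / FracField.tofrac ('X^n) /\
    forall i, ipow I (i - n) p`_i.

Definition fg_projective (A : comNzRingType) (P : lmodType A) : Prop :=
  exists (n : nat) (i : {linear P -> 'rV[A]_n}) (pi : {linear 'rV[A]_n -> P}),
    cancel i pi.

(* rank P > d (over a domain): P contains d+1 A-linearly independent elements. *)
Definition rank_gt (A : comNzRingType) (P : lmodType A) (d : nat) : Prop :=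
  exists v : 'I_d.+1 -> P, forall c : 'I_d.+1 -> A,
    \sum_(j < d.+1) c j *: v j = 0 -> forall j, c j = 0.

Definition unimodular (A : comNzRingType) (P : lmodType A) (p : P) : Prop :=
  forall a : A, exists phi : {linear P -> A^o}, phi p = a.

(* Main.v *)
(* Every f.g. projective P of rank r > d over A = R[It] becomes free over A_s for some nonzero s in
   R, with A_s = R_s[v] or R_s[v, 1/v]. Since A/sA and R_{s(1+sR)}[v] have dimension at most d,
   Kronecker's theorem lets us choose p in P which is unimodular modulo s, and whose coordinates
   h(v) over R_s[v] are unimodular after localizing at 1 + sR, with h(0) unimodular over R_s. If
   s^i u lies in (h) with u in 1 + sR, pick mu in uR with 1 - mu in s^2 R: then the element with
   coordinates h(mu v) is congruent to p modulo s, to h(0) modulo u, and s^i u lies in (h(mu v)),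
   so it is unimodular. The dimension bounds rest on dim B[X] = dim B + 1 for B noetherian, which
   comes from Krull's principal ideal theorem.

   Quotients and localizations are avoided throughout: ideals are predicates, and dimensions of
   S^-1(C/J) are measured by prime chains of C starting above J and ending outside S. *)
Require Import Defs.
From HB Require Import structures.
From mathcomp Require Import all_boot all_order all_algebra.
From mathcomp Require Import boolp.
From mathcomp Require Import ring.
Import GRing.Theory.
Local Open Scope ring_scope.
Set Implicit Arguments. Unset Strict Implicit. Unset Printing Implicit Defensive.

(** * Ideals, prime chains and Kronecker's theorem *)

(** Freeness over A_s holds because Frac(R)[v] is a principal ideal domain; clearing denominators
    leaves a single s in R. For R[It] one takes v = at with a nonzero in I, for the extended algebra
    v = 1/t. If I = 0, then R[It] = R has no room for v: the module is extended to R[X] and the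
    result is specialised at X = 0. The obstacle is that p is controlled modulo s and its
    coordinates only after inverting s and 1 + sR, so that the primes containing u are left over.
    Replacing v by mu v is aimed at exactly these primes, and it preserves the relation s^i u in (h)
    because s^i u does not involve v. Squares of s occur because a basis e and the coordinate map
    psi of P over A_s are scaled so that e psi = s: adding z e to p moves the coordinates by s z,
    and z itself must be divisible by s for p to stay the same modulo s. *)

Section Ideals.
Variable C : comNzRingType.
Implicit Types (J Q T : C -> Prop) (x y : C).

Lemma ideal0 J : is_ideal J -> J 0. Proof. by case. Qed.

Lemma idealD J x y : is_ideal J -> J x -> J y -> J (x + y).
Proof. by case=> _ + _; apply. Qed.

Lemma ideal_mull J x y : is_ideal J -> J y -> J (x * y).
Proof. by case=> _ _; apply. Qed.

Lemma ideal_mulr J x y : is_ideal J -> J x -> J (x * y).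
Proof. by rewrite mulrC; apply: ideal_mull. Qed.

Lemma idealN J x : is_ideal J -> J x -> J (- x).
Proof. by move=> iJ; rewrite -mulN1r; apply: ideal_mull. Qed.

Lemma idealB J x y : is_ideal J -> J x -> J y -> J (x - y).
Proof. by move=> iJ Jx Jy; apply: idealD => //; apply: idealN. Qed.

Lemma idealDl J x y : is_ideal J -> J x -> J (x + y) -> J y.
Proof. by move=> iJ Jx /(idealB iJ)/(_ Jx); rewrite addrAC subrr add0r. Qed.

Lemma idealDr J x y : is_ideal J -> J y -> J (x + y) -> J x.
Proof. by rewrite addrC; apply: idealDl. Qed.

Lemma ideal_sum J : is_ideal J ->
  forall (I : Type) (r : seq I) (P : pred I) (F : I -> C),
  (forall i, P i -> J (F i)) -> J (\sum_(i <- r | P i) F i).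
Proof.
move=> iJ I r P F JF; apply: (big_ind J) => //; first exact: ideal0.
by move=> x y; apply: idealD.
Qed.

Lemma prime_ideal Q : is_prime_ideal Q -> is_ideal Q. Proof. by case. Qed.

Lemma prime1 Q : is_prime_ideal Q -> ~ Q 1. Proof. by case. Qed.

Lemma primeM Q x y : is_prime_ideal Q -> Q (x * y) -> Q x \/ Q y.
Proof. by case=> _ _; apply. Qed.

Lemma primeX Q x n : is_prime_ideal Q -> Q (x ^+ n) -> Q x.
Proof.
move=> pQ; elim: n => [|n IH]; first by rewrite expr0 => /(prime1 pQ).
by rewrite exprS => /(primeM pQ)[].
Qed.

Definition mult_closed T := T 1 /\ forall x y, T x -> T y -> T (x * y).

Definition lincomb J k (g : nat -> C) : C -> Prop :=
  fun x => exists c : nat -> C, J (x - \sum_(i < k) c i * g i).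

Lemma lincomb_ideal J k g : is_ideal J -> is_ideal (lincomb J k g).
Proof.
move=> iJ; split.
- exists (fun=> 0); rewrite big1 ?subr0; first exact: ideal0.
  by move=> i _; rewrite mul0r.
- move=> x y [c Jc] [c' Jc']; exists (fun i => c i + c' i).
  under eq_bigr do rewrite mulrDl.
  rewrite big_split /= opprD addrACA; exact: idealD.
- move=> r x [c Jc]; exists (fun i => r * c i).
  under eq_bigr do rewrite -mulrA.
  rewrite -mulr_sumr -mulrBr; exact: ideal_mull.
Qed.

Lemma lincombl J k g x : is_ideal J -> J x -> lincomb J k g x.
Proof.
move=> iJ Jx; exists (fun=> 0); rewrite big1 ?subr0 // => i _.
by rewrite mul0r.
Qed.

Lemma lincombr J k g i : is_ideal J -> (i < k)%N -> lincomb J k g (g i).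
Proof.
move=> iJ ltik; exists (fun j => (j == i)%:R).
rewrite (bigD1 (Ordinal ltik)) //= eqxx mul1r big1 ?addr0 ?subrr; first exact: ideal0.
by move=> j; rewrite -val_eqE /= => /negPf->; rewrite mul0r.
Qed.

Definition adjoin J y : C -> Prop := fun x => exists c, J (x - c * y).

Lemma adjoin_ideal J y : is_ideal J -> is_ideal (adjoin J y).
Proof.
move=> iJ; split.
- by exists 0; rewrite mul0r subr0; apply: ideal0.
- move=> x x' [c Jc] [c' Jc']; exists (c + c'); rewrite mulrDl opprD addrACA.
  exact: idealD.
- move=> r x [c Jc]; exists (r * c); rewrite -mulrA -mulrBr; exact: ideal_mull.
Qed.

Lemma adjoinl J y x : J x -> adjoin J y x.
Proof. by move=> Jx; exists 0; rewrite mul0r subr0. Qed.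

Lemma adjoinr J y : is_ideal J -> adjoin J y y.
Proof. by move=> iJ; exists 1; rewrite mul1r subrr; apply: ideal0. Qed.

Lemma zero_ideal : is_ideal (fun x : C => x = 0).
Proof. by split=> // [x y -> ->|r x ->]; rewrite ?addr0 ?mulr0. Qed.

Hypothesis noethC : noetherian C.

Lemma noeth_max (Pr : (C -> Prop) -> Prop) J0 : is_ideal J0 -> Pr J0 ->
  exists J, [/\ is_ideal J, Pr J, (forall x, J0 x -> J x) &
    forall J', is_ideal J' -> Pr J' -> (forall x, J x -> J' x) ->
      forall x, J' x -> J x].
Proof.
move=> iJ0 PJ0; apply: contrapT => nmax.
pose good J := [/\ is_ideal J, Pr J & forall x, J0 x -> J x].
have next (J : {J | good J}) : {J' : {J | good J} |
    (forall x, sval J x -> sval J' x) /\ exists x, sval J' x /\ ~ sval J x}.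
  apply: cid; case: J => J [iJ PJ J0J] /=; apply: contrapT => nJ'.
  apply: nmax; exists J; split=> // J' iJ' PJ' JJ' x J'x; apply: contrapT => nJx.
  apply: nJ'; have gJ' : good J' by split=> // y /J0J/JJ'.
  by exists (exist _ J' gJ'); split=> //; exists x.
have gJ0 : good J0 by split.
pose Jn n := iter n (fun U => sval (next U)) (exist _ J0 gJ0).
have [|n x Jx|N stab] := @noethC (fun n => sval (Jn n)).
- by move=> n; case: (svalP (Jn n)).
- by rewrite /Jn iterS; case: (svalP (next (Jn n))) => + _; apply.
have [_ [x [Jx nJx]]] := svalP (next (Jn N)).
by apply: nJx; apply: (stab N.+1) => //; rewrite /Jn iterS.
Qed.

Lemma exists_prime J T : is_ideal J -> mult_closed T ->
  (forall x, J x -> ~ T x) ->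
  exists Q, [/\ is_prime_ideal Q, (forall x, J x -> Q x) & forall x, Q x -> ~ T x].
Proof.
move=> iJ [T1 TM] JT.
have [Q [iQ QT JQ maxQ]] := noeth_max (Pr := fun J => forall x, J x -> ~ T x) iJ JT.
exists Q; split=> //; split=> //; first by move=> /QT.
have meet a : ~ Q a -> exists t, T t /\ adjoin Q a t.
  move=> nQa; apply: contrapT => nt; apply: nQa.
  apply: (maxQ (adjoin Q a)); [exact: adjoin_ideal| |by move=> x; apply: adjoinl|exact: adjoinr].
  by move=> x Qx Tx; apply: nt; exists x.
move=> a b Qab; apply: contrapT => /not_orP[/meet[t [Tt [c Qt]]] /meet[t' [Tt' [c' Qt']]]].
apply: (QT (t * t')); last exact: TM.
have -> : t * t' = (t - c * a) * t' + (t' - c' * b) * (c * a) + c * c' * (a * b) by ring.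
by apply: idealD => //; [apply: idealD => //; apply: ideal_mulr|apply: ideal_mull].
Qed.

(** Turns a statement about all primes, the form in which [kronecker] concludes, into an actual
    element of J. *)
Lemma meets J T : is_ideal J -> mult_closed T ->
  (forall Q, is_prime_ideal Q -> (forall x, J x -> Q x) -> exists x, Q x /\ T x) ->
  exists x, J x /\ T x.
Proof.
move=> iJ mT H; apply: contrapT => nJT.
have [|Q [pQ JQ QT]] := exists_prime iJ mT.
  by move=> x Jx Tx; apply: nJT; exists x.
by have [x [/QT]] := H Q pQ JQ.
Qed.

Lemma exists_prime_ge J : is_ideal J -> ~ J 1 ->
  exists Q, is_prime_ideal Q /\ forall x, J x -> Q x.
Proof.
move=> iJ nJ1; have [||Q [pQ JQ _]] := @exists_prime J (fun x => x = 1) iJ.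
- by split=> // x y -> ->; rewrite mulr1.
- by move=> x Jx x1; apply: nJ1; rewrite -x1.
by exists Q.
Qed.

End Ideals.

Section Chains.
Variable C : comNzRingType.
Implicit Types (J Q T : C -> Prop) (c : nat -> C -> Prop).

(** [n] counts inclusions, so there are n + 1 primes. The top prime is named separately, up to
    equivalence, so that it can be presented as a contraction or a preimage. *)
Definition chain_over J n c Q :=
  [/\ prime_chain n c, (forall x, J x -> c 0 x) & (forall x, c n x <-> Q x)].

Lemma chain_over_eq J n c Q Q' : (forall x, Q x <-> Q' x) ->
  chain_over J n c Q -> chain_over J n c Q'.
Proof. by move=> QQ' [pc Jc cQ]; split=> // x; rewrite cQ. Qed.

Lemma chain_over_prime J n c Q : chain_over J n c Q -> is_prime_ideal Q.
Proof.
move=> [[pc _] _ cQ]; have -> : Q = c n by apply/funext => x; apply/propext; split=> /cQ.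
exact: pc.
Qed.

Lemma chain_over_rcons J n c Q Q' : chain_over J n c Q -> is_prime_ideal Q' ->
  (forall x, Q x -> Q' x) -> (exists x, Q' x /\ ~ Q x) ->
  exists c', chain_over J n.+1 c' Q'.
Proof.
move=> [[pc inc] Jc cQ] pQ' QQ' [x [Q'x nQx]].
exists (fun i => if (i <= n)%N then c i else Q'); split=> //=; last by move=> y; rewrite ltnn.
split=> i lein.
  by case: ifP => // lein'; exact: pc.
rewrite ltnS in lein; rewrite lein; case: ltnP => ltin; first exact: inc.
have -> : i = n by apply/eqP; rewrite eqn_leq lein ltin.
by split; [move=> y /cQ/QQ'|exists x; split=> // /cQ].
Qed.

Lemma chain_over_cons J J' n c Q P : chain_over J n c Q -> is_prime_ideal P ->
  (forall x, J' x -> P x) -> (forall x, P x -> J x) -> (exists x, J x /\ ~ P x) ->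
  exists c', chain_over J' n.+1 c' Q.
Proof.
move=> [[pc inc] Jc cQ] pP J'P PJ [x [Jx nPx]].
exists (fun i => if i is i'.+1 then c i' else P); split=> //; split=> [[|i]|[|i]] //.
- exact: pc.
- by split; [move=> y /PJ/Jc|exists x; split=> //; apply: Jc].
- by rewrite ltnS; apply: inc.
Qed.

Lemma chain_over_behead J n c Q : chain_over J n.+1 c Q ->
  exists c', chain_over J n c' Q.
Proof.
move=> [[pc inc] Jc cQ]; exists (c \o S); split=> //.
  by split=> i lein; [apply: pc|apply: inc].
by move=> x /Jc; case: (inc 0%N _) => // + _; apply.
Qed.

Lemma chain_over_belast J n c Q : chain_over J n.+1 c Q -> chain_over J n c (c n).
Proof. by move=> [[pc inc] Jc _]; split=> //; split=> i lin; [apply: pc|apply: inc]; apply: ltnW. Qed.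

Lemma chain_over_shorten J m n c Q : (m <= n)%N -> chain_over J n c Q ->
  exists c', chain_over J m c' Q.
Proof.
elim: n c => [|n IH] c; first by rewrite leqn0 => /eqP->; exists c.
rewrite leq_eqVlt => /predU1P[->|lemn]; first by exists c.
by move=> /chain_over_behead[c' /IH]; apply.
Qed.

Hypothesis noethC : noetherian C.

(** Induction on k through the boundary ideal J' = (rad J : b_0) + (b_0): no prime containing it is
    minimal over J, so the dimension of T^-1(C/J) drops. Over J' the induction gives u a^n = y + e_0
    b_0 + (a combination of the other b_i + a x_i) with y b_0 in rad J, and y is taken for x_0. *)
Lemma kronecker T k J a (b : nat -> C) : mult_closed T -> is_ideal J ->
  (forall c Q, chain_over J k c Q -> exists x, Q x /\ T x) ->
  exists x : nat -> C, forall Q, is_prime_ideal Q -> (forall y, J y -> Q y) ->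
    (forall y, Q y -> ~ T y) -> (forall i, (i < k)%N -> Q (b i + a * x i)) -> Q a.
Proof.
move=> mT; have [T1 TM] := mT; elim: k J b => [|k IH] J b iJ dimC.
  exists (fun=> 0) => Q pQ JQ QT _; have [|x [/QT]//] := dimC (fun=> Q) Q.
  by split=> //; split=> [//|i]; rewrite ltn0.
pose N y := forall Q, is_prime_ideal Q -> (forall y, J y -> Q y) -> Q (y * b 0%N).
have iN : is_ideal N.
  split.
  - by move=> Q pQ _; rewrite mul0r; exact: ideal0 (prime_ideal pQ).
  - move=> x y Nx Ny Q pQ JQ; rewrite mulrDl; have iQ := prime_ideal pQ.
    by apply: (idealD iQ); [apply: Nx|apply: Ny].
  - by move=> r x Nx Q pQ JQ; rewrite -mulrA; apply: ideal_mull; [apply: prime_ideal|apply: Nx].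
have JN y : J y -> N y.
  by move=> Jy Q pQ JQ; apply: ideal_mulr; [apply: prime_ideal|apply: JQ].
pose J' := adjoin N (b 0%N).
have iJ' : is_ideal J' by exact: adjoin_ideal.
have [|x' x'P] := IH J' (b \o S) iJ'.
  move=> c Q [[pc inc] J'c cQ].
  (* A prime over J, inside [c 0], that avoids b_0 and prolongs the chain downwards. If b_0^n u were
     in J with u outside [c 0], then u b_0 would be in rad J, so u in N, which lies in [c 0]. *)
  have [P [pP JP PT]] : exists P, [/\ is_prime_ideal P, (forall x, J x -> P x) &
      forall x, P x -> ~ (exists n u, ~ c 0%N u /\ x = b 0%N ^+ n * u)].
    have pc0 := pc 0%N isT.
    apply: (exists_prime noethC) => //.
      split; first by exists 0%N, 1; rewrite mulr1 expr0; split=> //; apply: prime1.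
      move=> _ _ [n [u [nu ->]]] [n' [u' [nu' ->]]]; exists (n + n')%N, (u * u').
      by split; [move=> /(primeM pc0)[]|rewrite exprD mulrACA].
    move=> x Jx [n [u [nu xE]]]; apply/nu/J'c; apply: adjoinl => P pP JP.
    have iP := prime_ideal pP; move: (JP _ Jx); rewrite xE => /(primeM pP)[/(primeX pP)|] Pu.
      exact: ideal_mull.
    exact: ideal_mulr.
  have Pc0 x : P x -> c 0%N x.
    by move=> Px; apply: contrapT => nx; apply: (PT x Px); exists 0%N, x; rewrite expr0 mul1r.
  have [||c' c'P] := @chain_over_cons (c 0%N) J k c Q P _ pP JP Pc0.
  - by split.
  - exists (b 0%N); split; first by apply: J'c; apply: adjoinr.
    move=> Pb; apply: (PT _ Pb); exists 1%N, 1; rewrite expr1 mulr1; split=> //.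
    by apply: prime1; apply: pc.
  exact: dimC c'P.
pose g i := b i.+1 + a * x' i.
have [t [[e J't] [n [u [Tu tE]]]]] : exists t, lincomb J' k g t /\ exists n u, T u /\ t = u * a ^+ n.
  apply: meets => //; first exact: lincomb_ideal.
    split; first by exists 0%N, 1; rewrite expr0 mulr1.
    move=> _ _ [n [u [nu ->]]] [n' [u' [nu' ->]]]; exists (n + n')%N, (u * u').
    by split; [apply: TM|rewrite exprD mulrACA].
  move=> Q pQ J'Q; case: (pselect (exists y, Q y /\ T y)) => [[y [Qy Ty]]|nQT].
    by exists y; split=> //; exists 0%N, y; rewrite expr0 mulr1.
  exists a; split; last by exists 1%N, 1; rewrite expr1 mul1r.
  apply: (x'P) => //.
  - by move=> y J'y; apply: J'Q; apply: lincombl.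
  - by move=> y Qy Ty; apply: nQT; exists y.
  - by move=> i ltik; apply/J'Q; exact: (@lincombr _ J' k g).
case: J't => e0; set y := (X in N X) => Ny.
(* Since y b_0 is in Q, one of y and b_0 is; with b_0 + a y in Q and a outside Q both are, and then
   so is u a^n. *)
exists (fun i => if i is i'.+1 then x' i' else y) => Q pQ JQ QT Qg.
have iQ := prime_ideal pQ; apply: contrapT => nQa.
have Qg0 := Qg 0%N isT; rewrite /= in Qg0.
have [Qb Qy] : Q (b 0%N) /\ Q y.
  have [Qy|Qb] := primeM pQ (Ny Q pQ JQ).
    by split=> //; apply: (idealDr iQ _ Qg0); apply: ideal_mull.
  by split=> //; have /(primeM pQ)[//|] := idealDl iQ Qb Qg0.
have Qt : Q t.
  have -> : t = y + e0 * b 0%N + \sum_(i < k) e i * g i by rewrite /y subrK subrK.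
  apply: (idealD iQ); first by apply: (idealD iQ Qy); apply: ideal_mull.
  by apply: (ideal_sum iQ) => i _; apply: (ideal_mull _ iQ); apply: (Qg i.+1 (ltn_ord i)).
by move: Qt; rewrite tE => /(primeM pQ)[/QT/(_ Tu)//|/(primeX pQ)/nQa].
Qed.

End Chains.

(** * Krull's principal ideal theorem *)

Section PrincipalIdealTheorem.
Variable C : comNzRingType.
Hypothesis noethC : noetherian C.
Variable p : C -> Prop.
Hypothesis pp : is_prime_ideal p.
Implicit Types (J K Q : C -> Prop).

Definition saturated J := forall w x, ~ p w -> J (w * x) -> J x.
Definition sat J : C -> Prop := fun x => exists w, ~ p w /\ J (w * x).

Lemma notpM w w' : ~ p w -> ~ p w' -> ~ p (w * w').
Proof. by move=> nw nw' /(primeM pp)[]. Qed.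

Lemma sat_ideal J : is_ideal J -> is_ideal (sat J).
Proof.
move=> iJ; split.
- by exists 1; split; [exact: prime1|rewrite mulr0; apply: ideal0].
- move=> x y [w [nw Jx]] [w' [nw' Jy]]; exists (w * w'); split; first exact: notpM.
  have -> : w * w' * (x + y) = w' * (w * x) + w * (w' * y) by ring.
  by apply: (idealD iJ); apply: ideal_mull.
- by move=> r x [w [nw Jx]]; exists w; split=> //; rewrite mulrCA; apply: ideal_mull.
Qed.

Lemma sub_sat J x : J x -> sat J x.
Proof. by move=> Jx; exists 1; split; [exact: prime1|rewrite mul1r]. Qed.

Lemma saturated_sat J : saturated (sat J).
Proof.
move=> w x nw [w' [nw' Jx]]; exists (w' * w); split; first exact: notpM.
by rewrite -mulrA.
Qed.

(** Nakayama in the local ring at p modulo J, for a mere subset M. Up to units h_n = a h_{n+1}, so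
    the ideals (h_n) increase and become stationary; then (1 - a c) h_N = 0 with 1 - a c a unit, and
    vanishing passes from h_N back to h_0. *)
Lemma saturated_nakayama J (M : C -> Prop) a : is_ideal J -> saturated J -> p a ->
  (forall h, M h -> exists w h', [/\ ~ p w, M h' & J (w * h - a * h')]) ->
  forall h, M h -> J h.
Proof.
move=> iJ sJ pa step h0 Mh0.
have next (h : {h | M h}) : {h' : {h | M h} |
    exists w, ~ p w /\ J (w * sval h - a * sval h')}.
  apply: cid; case: h => h Mh /=; have [w [h' [nw Mh' Jh]]] := step h Mh.
  by exists (exist _ h' Mh'), w.
pose hn n := iter n (fun u => sval (next u)) (exist _ h0 Mh0).
have hnP n : exists w, ~ p w /\ J (w * sval (hn n) - a * sval (hn n.+1)).
  by have := svalP (next (hn n)); rewrite /hn iterS.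
have [||N stab] := @noethC (fun n => sat (adjoin J (sval (hn n)))).
- by move=> n; apply: sat_ideal; apply: adjoin_ideal.
- move=> n x [w [nw [c Jc]]]; have [w' [nw' Jn]] := hnP n.
  exists (w' * w); split; first exact: notpM.
  exists (c * a).
  have -> : w' * w * x - c * a * sval (hn n.+1) = w' * (w * x - c * sval (hn n))
      + c * (w' * sval (hn n) - a * sval (hn n.+1)) by ring.
  by apply: (idealD iJ); apply: ideal_mull.
have JN : J (sval (hn N)).
  have [w [nw JwN]] := hnP N.
  have [|w' [nw' [c Jc]]] := stab N.+1 (leqnSn N) (sval (hn N.+1)).
    by apply: sub_sat; apply: adjoinr.
  apply: (sJ (w' * w - a * c)).
    have ip := prime_ideal pp; move=> H; apply: (notpM nw' nw); apply: (idealDr ip _ H).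
    by apply: (idealN ip); apply: (ideal_mulr _ ip).
  have -> : (w' * w - a * c) * sval (hn N) =
    w' * (w * sval (hn N) - a * sval (hn N.+1)) +
    a * (w' * sval (hn N.+1) - c * sval (hn N)) by ring.
  by apply: (idealD iJ); apply: ideal_mull.
suff: forall n, (n <= N)%N -> J (sval (hn (N - n)%N)).
  by move=> /(_ N (leqnn N)); rewrite subnn.
elim=> [|n IH] ltnN; first by rewrite subn0.
have [w [nw]] := hnP (N - n.+1)%N; rewrite subnSK // => JwN.
apply: (sJ w) => //; apply: (idealDr iJ _ JwN); apply: idealN => //; apply: ideal_mull => //.
by apply: IH; apply: ltnW.
Qed.

Variable p0 : C -> Prop.
Hypothesis pp0 : is_prime_ideal p0.
Variable a : C.
Hypothesis pa : p a.
Hypothesis min_p : forall Q, is_prime_ideal Q -> (forall x, p0 x -> Q x) -> Q a ->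
  (forall x, Q x -> p x) -> forall x, p x -> Q x.

(* The local ring at p modulo p0 + (a) is zero-dimensional, hence artinian. *)
Lemma dcc_over_minimal (K : nat -> C -> Prop) :
  (forall n, [/\ is_ideal (K n), saturated (K n), (forall x, p0 x -> K n x) & K n a]) ->
  (forall n x, K n.+1 x -> K n x) ->
  exists n, forall x, K n x -> K n.+1 x.
Proof.
move=> Kn decK.
have leK m n x : (m <= n)%N -> K n x -> K m x.
  move=> /subnK <-; elim: (n - m)%N => // k IH; rewrite addSn => /decK; exact: IH.
(* Noetherian induction on ideals J inside which the K n are eventually constant: a maximal such J
   is shown to be the whole ring. *)
pose Pr J := [/\ saturated J, (forall x, p0 x -> J x), J a &
  exists N, forall n, (N <= n)%N -> forall x, K N x -> J x -> K n x].
have [||J [iJ [sJ p0J Ja [N stab]] _ maxJ]] :=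
  @noeth_max _ noethC Pr (sat (adjoin p0 a)).
- by apply: sat_ideal; apply: adjoin_ideal; apply: prime_ideal.
- split; first exact: saturated_sat.
  + by move=> x p0x; apply: sub_sat; apply: adjoinl.
  + by apply: sub_sat; apply: adjoinr; apply: prime_ideal.
  + exists 0%N => n _ x _ [w [nw [c pc]]]; have [iK sK p0K Ka] := Kn n.
    apply: (sK w) => //; rewrite -(subrK (c * a) (w * x)).
    by apply: (idealD iK); [apply: p0K|apply: ideal_mull].
have [J1|nJ1] := pselect (J 1).
  exists N => x Kx; apply: (stab N.+1) => //.
  by rewrite -[x]mulr1; apply: ideal_mull.
have iC y : is_ideal (fun x => J (x * y)).
  split=> [|x x'|r x]; first by rewrite mul0r; apply: ideal0.
    by rewrite mulrDl; apply: idealD.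
  by rewrite -mulrA; apply: ideal_mull.
(* A maximal annihilator (J : y) is an associated prime. It contains p0 and a and lies inside p, so
   it equals p by minimality. *)
have [|I [iI [y [nJy Iy]] JI maxI]] := @noeth_max _ noethC
  (fun I => exists y, ~ J y /\ forall x, I x <-> J (x * y)) J iJ.
  by exists 1; split=> // x; rewrite mulr1.
have pI : is_prime_ideal I.
  split=> //; first by move=> /Iy; rewrite mul1r.
  move=> u v /Iy Juv; have [Ju|nJu] := pselect (J (u * y)); [by left; apply/Iy|right].
  apply: (maxI (fun x => J (x * (u * y)))) => //; first by exists (u * y).
  - by move=> x /Iy Jx; rewrite mulrCA; apply: ideal_mull.
  - by rewrite mulrCA mulrA.
have pI' : forall x, p x -> J (x * y).
  move=> x px; apply/Iy; apply: (min_p pI) => //.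
  - by move=> z /p0J/JI.
  - exact: JI.
  - by move=> z /Iy Jz; apply: contrapT => npz; apply: nJy; apply: sJ Jz.
exfalso; apply: nJy; apply: (maxJ (sat (adjoin J y))).
- by apply: sat_ideal; apply: adjoin_ideal.
- split; first exact: saturated_sat.
  + by move=> x p0x; apply: sub_sat; apply: adjoinl; apply: p0J.
  + by apply: sub_sat; apply: adjoinl.
  (* As p y lies in J, the module (J + (y)) / J is simple locally at p. Either every K n with n >= N
     hits it, hence covers it, or from some N' on K n meets J + (y) only inside J; in both cases the
     K n stabilise on the larger ideal, against maximality. *)
  have [H|] := pselect (forall n, (N <= n)%N -> exists g,
     [/\ K n g, sat (adjoin J y) g & ~ J g]).
    exists N => n leNn x KNx [w' [nw' [h' Jh']]].
    have [g [Kg [w [nw [h Jh]]] nJg]] := H n leNn.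
    have [iK sK _ _] := Kn n; have [iKN _ _ _] := Kn N.
    have nh : ~ p h.
      by move=> /pI' Jhy; apply: nJg; apply: (sJ w) => //; apply: (idealDr iJ _ Jh); apply: idealN.
    apply: (sK (h * w')); first exact: notpM.
    have := ideal_mull (h' * w) iK Kg; move: (stab n leNn) => stabn.
    rewrite -[X in _ -> K n X](subrK (h' * w * g)); move=> Kwg; apply: (idealD iK) => //.
    apply: stabn.
      by apply: (idealB iKN); apply: ideal_mull => //; apply: leK Kg.
    have -> : h * w' * x - h' * w * g = h * (w' * x - h' * y) - h' * (w * g - h * y) by ring.
    by apply: (idealB iJ); apply: ideal_mull.
  move=> /existsNP[N' /not_implyP[leNN' noext]].
  exists N' => n leN'n x KN'x J'x; apply: (stab n (leq_trans leNN' leN'n)).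
    exact: leK KN'x.
  by apply: contrapT => nJx; apply: noext; exists x.
- by move=> x Jx; apply: sub_sat; apply: adjoinl.
- by apply: sub_sat; apply: adjoinr.
Qed.

(* The chain J n below is the preimage of the powers of c in the localization at p and a,
   taken modulo p0. *)
Lemma principal_ideal_theorem P' : is_prime_ideal P' -> (forall x, p0 x -> P' x) ->
  (forall x, P' x -> p x) -> (exists x, p x /\ ~ P' x) -> forall x, P' x -> p0 x.
Proof.
move=> pP' p0P' P'p [x0 [px0 nP'x0]] c P'c; apply: contrapT => np0c.
have nP'a : ~ P' a by move=> P'a; apply: nP'x0; apply: (min_p pP').
have ip0 := prime_ideal pp0; have ip := prime_ideal pp.
pose J n y := exists w k e, ~ p w /\ p0 (w * a ^+ k * y - e * c ^+ n).
have iJ n : is_ideal (J n).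
  split.
  - exists 1, 0%N, 0; split; first exact: prime1.
    by rewrite mulr0 mul0r subrr; apply: ideal0.
  - move=> x y [w [k [e [nw px]]]] [w' [k' [e' [nw' py]]]].
    exists (w * w'), (k + k')%N, (e * w' * a ^+ k' + e' * w * a ^+ k).
    split; first exact: notpM.
    have -> : w * w' * a ^+ (k + k') * (x + y) -
      (e * w' * a ^+ k' + e' * w * a ^+ k) * c ^+ n =
      (w' * a ^+ k') * (w * a ^+ k * x - e * c ^+ n) +
      (w * a ^+ k) * (w' * a ^+ k' * y - e' * c ^+ n) by rewrite exprD; ring.
    by apply: (idealD ip0); apply: ideal_mull.
  - move=> r x [w [k [e [nw px]]]]; exists w, k, (r * e); split=> //.
    have -> : w * a ^+ k * (r * x) - r * e * c ^+ n = r * (w * a ^+ k * x - e * c ^+ n) by ring.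
    exact: ideal_mull.
have sJ n : saturated (J n).
  move=> w x nw [w' [k [e [nw' px]]]]; exists (w' * w), k, e; split; first exact: notpM.
  by have -> : w' * w * a ^+ k * x = w' * a ^+ k * (w * x) by ring.
have aJ n x : J n (a * x) -> J n x.
  move=> [w' [k [e [nw' px]]]]; exists w', k.+1, e; split=> //.
  by have -> : w' * a ^+ k.+1 * x = w' * a ^+ k * (a * x) by rewrite exprS; ring.
have p0J n x : p0 x -> J n x.
  move=> px; exists 1, 0%N, 0; split; first exact: prime1.
  by rewrite expr0 !mul1r mul0r subr0.
have decJ n x : J n.+1 x -> J n x.
  move=> [w [k [e [nw px]]]]; exists w, k, (e * c); split=> //.
  by have -> : e * c * c ^+ n = e * c ^+ n.+1 by rewrite exprS mulrA.
have [||n stab] := @dcc_over_minimal (fun n => sat (adjoin (J n) a)).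
- move=> n; split.
  + by apply: sat_ideal; apply: adjoin_ideal.
  + exact: saturated_sat.
  + by move=> x /p0J; move=> /(_ n) Jx; apply: sub_sat; apply: adjoinl.
  + by apply: sub_sat; apply: adjoinr.
- by move=> n x [w [nw [e Je]]]; exists w; split=> //; exists e; apply: decJ.
(* For h in J n, stability modulo a gives w h = e a + (an element of J n.+1). Then e a is in J n,
   hence so is e because J n is the preimage of an ideal where a is invertible, and Nakayama
   applies. *)
have Jstab : forall y, J n y -> J n.+1 y.
  apply: (saturated_nakayama (a := a)) => // h Jh.
  have [|w [nw [e Je]]] := stab h; first by apply: sub_sat; apply: adjoinl.
  exists w, e; split=> //; last by rewrite mulrC in Je *; rewrite [a * e]mulrC.
  apply: aJ; rewrite mulrC; rewrite -[e * a](subKr (w * h)); apply: (idealB (iJ n)).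
    exact: ideal_mull.
  exact: decJ.
have [|w [k [e [nw]]]] := Jstab (c ^+ n).
  exists 1, 0%N, 1; split; first exact: prime1.
  by rewrite expr0 !mul1r subrr; apply: ideal0.
have -> : w * a ^+ k * c ^+ n - e * c ^+ n.+1 = (w * a ^+ k - e * c) * c ^+ n.
  by rewrite exprS; ring.
(* As c is not in p0, w a^k - e c is in p0, so w a^k is in P'; but w and a are both outside P'. *)
move=> /(primeM pp0)[/p0P'|/(primeX pp0)//] H.
have iP' := prime_ideal pP'.
have /(primeM pP')[/P'p//|/(primeX pP')//] : P' (w * a ^+ k).
by apply: (idealDr iP' _ H); apply: idealN => //; apply: ideal_mull.
Qed.

End PrincipalIdealTheorem.

(** * Dimension of polynomial rings *)

(** [L n k] increases in both n and k. The diagonal L n n becomes stationary at N, which settles all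
    k >= N at once; the finitely many k < N are stabilised separately, and M dominates all these
    thresholds. *)
Lemma hilbert_basis (B : comNzRingType) : noetherian B -> noetherian {poly B}.
Proof.
move=> noethB J iJ incJ.
have leJ m n f : (m <= n)%N -> J m f -> J n f.
  by move=> /subnK <-; elim: (n - m)%N => // k IH /IH /incJ.
pose L n k c := exists f, [/\ J n f, (size f <= k.+1)%N & f`_k = c].
have iL n k : is_ideal (L n k).
  split.
  - by exists 0; rewrite size_poly0 coef0; split=> //; apply: ideal0.
  - move=> x y [f [Jf sf <-]] [g [Jg sg <-]]; exists (f + g); rewrite coefD; split=> //.
      exact: idealD.
    by apply: (leq_trans (size_polyD _ _)); rewrite geq_max sf.
  - move=> r x [f [Jf sf <-]]; exists (r%:P * f); rewrite coefCM; split=> //.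
      exact: ideal_mull.
    by rewrite mul_polyC; apply: leq_trans (size_scale_leq _ _) sf.
have Lk n k k' x : (k <= k')%N -> L n k x -> L n k' x.
  move=> /subnK <-; elim: (k' - k)%N => // i IH /IH [f [Jf sf <-]].
  exists (f * 'X); rewrite addSn coefMX; split=> //; first exact: ideal_mulr.
  by apply: leq_trans (size_polyMleq _ _) _; rewrite size_polyX addn2.
have Ln n n' k x : (n <= n')%N -> L n k x -> L n' k x.
  by move=> le [f [Jf sf fk]]; exists f; split=> //; apply: leJ Jf.
have [||N stabN] := noethB (fun n => L n n) _ _; first by move=> n.
  by move=> n x /(Ln _ _ _ _ (leqnSn n)) /(Lk _ _ _ _ (leqnSn n)).
have stab k : exists M, forall n, (M <= n)%N -> forall x, L n k x -> L M k x.
  by apply: noethB => // n x; apply: Ln.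
pose M0 k := sval (cid (stab k)); have stabM k := svalP (cid (stab k)).
pose M := (N + \sum_(k < N) M0 k)%N.
exists M => n leMn f; have [s] := ubnP (size f); elim: s f => // s IH f; rewrite ltnS => sf Jf.
have [f0|nf0] := eqVneq f 0; first by rewrite f0; apply: ideal0.
have sfE : size f = (size f).-1.+1 by rewrite prednK // size_poly_gt0.
set k := (size f).-1 in sfE.
have : L n k f`_k by exists f; rewrite sfE.
have LM : L n k f`_k -> L M k f`_k.
  move=> Lf; have [leNk|ltkN] := leqP N k.
    apply: (Lk _ N) => //; apply: (Ln N) => //; first exact: leq_addr.
    apply: (stabN (maxn n k)); first by rewrite leq_max leNk orbT.
    by apply: (Ln n); [exact: leq_maxl|apply: (Lk _ k) => //; exact: leq_maxr].
  have leM0 : (M0 k <= M)%N.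
    by rewrite /M (bigD1 (Ordinal ltkN)) //= addnCA leq_addr.
  by apply: (Ln (M0 k)) => //; apply: (stabM k n) => //; exact: leq_trans leMn.
move=> /LM[g [Jg sg gk]]; rewrite -(subrK g f); apply: idealD => //; apply: IH.
  apply: leq_trans sf; rewrite sfE ltnS.
  apply/leq_sizeP => j; rewrite leq_eqVlt => /predU1P[<-|ltkj].
    by rewrite coefB gk subrr.
  by rewrite coefB !nth_default ?subr0 // ?sfE //; apply: leq_trans sg _.
by apply: idealB => //; apply: leJ Jg.
Qed.

Section PolyPrimes.
Variable B : idomainType.
Implicit Types (q : B -> Prop) (P Q : {poly B} -> Prop) (f g : {poly B}).

Definition extend q : {poly B} -> Prop := fun f => forall i, q f`_i.
Definition contract P : B -> Prop := fun b => P b%:P.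

Lemma contract_prime P : is_prime_ideal P -> is_prime_ideal (contract P).
Proof.
move=> pP; have iP := prime_ideal pP; split; first split.
- by rewrite /contract polyC0; apply: ideal0.
- by move=> x y; rewrite /contract polyCD; apply: idealD.
- by move=> x y; rewrite /contract polyCM; apply: ideal_mull.
- by rewrite /contract polyC1; apply: prime1.
- by move=> x y; rewrite /contract polyCM; apply: primeM.
Qed.

Lemma extend_ideal q : is_ideal q -> is_ideal (extend q).
Proof.
move=> iq; split.
- by move=> i; rewrite coef0; apply: ideal0.
- by move=> f g qf qg i; rewrite coefD; apply: idealD.
- move=> f g qg i; rewrite coefM; apply: (ideal_sum iq) => j _; exact: ideal_mull.
Qed.

Lemma extend_prime q : is_prime_ideal q -> is_prime_ideal (extend q).
Proof.
move=> pq; have iq := prime_ideal pq; split; first exact: extend_ideal.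
  by move=> /(_ 0%N); rewrite coefC /=; apply: prime1.
have first f : ~ extend q f -> exists i, ~ q f`_i /\ forall j, (j < i)%N -> q f`_j.
  move=> /existsNP nf; have ex : exists i, `[< ~ q f`_i >] by have [i ni] := nf; exists i; apply/asboolP.
  have [i /asboolP ni mini] := ex_minnP ex; exists i; split=> // j ltji; apply: contrapT => nj.
  by have := mini j; rewrite leqNgt ltji => /(_ (asboolT nj)).
move=> f g qfg; apply: contrapT => /not_orP[/first[i [ni fi]] /first[j [nj gj]]].
have := qfg (i + j)%N; rewrite coefM (bigD1 (inord i)) //=.
rewrite inordK ?ltnS ?leq_addr // addKn => qs.
have /(primeM pq)[]// : q (f`_i * g`_j).
apply: (idealDr iq _ qs); apply: (ideal_sum iq) => k; rewrite -val_eqE /= inordK ?ltnS ?leq_addr // => neki.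
have [ltki|leik] := ltnP k i; first by apply: ideal_mulr => //; apply: fi.
by apply: ideal_mull => //; apply: gj; rewrite ltn_subLR ?leq_ord // ltn_add2r ltn_neqAle eq_sym neki.
Qed.

Lemma extend_sub q P : is_ideal P -> (forall b, q b -> P b%:P) ->
  forall f, extend q f -> P f.
Proof.
move=> iP qP f qf; rewrite -[f]coefK poly_def; apply: (ideal_sum iP) => i _.
by rewrite -mul_polyC; apply: ideal_mulr => //; apply: qP.
Qed.

(** Take f of least degree in P outside q[X]: were its leading coefficient in q, removing the
    leading term would give a smaller one. Such an f replaces the generator of an ideal of
    Frac(B/q)[X] and is fit for pseudo-division. *)
Lemma min_lead q P : is_ideal q -> is_ideal P -> (forall b, q b -> P b%:P) ->
  (exists f, P f /\ ~ extend q f) ->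
  exists f, [/\ P f, ~ q (lead_coef f) &
    forall g, P g -> (size g < size f)%N -> extend q g].
Proof.
move=> iq iP qP exf.
have ex : exists n, `[< exists f, [/\ P f, ~ extend q f & size f = n] >].
  by have [f [Pf nf]] := exf; exists (size f); apply/asboolP; exists f.
have [n /asboolP[f [Pf nqf sf]] minn] := ex_minnP ex.
have minf g : P g -> (size g < size f)%N -> extend q g.
  move=> Pg ltg; apply: contrapT => ng.
  have /minn : `[< exists f, [/\ P f, ~ extend q f & size f = size g] >] by apply/asboolP; exists g.
  by rewrite -sf leqNgt ltg.
exists f; split=> // ql.
have f0 : f != 0 by apply/eqP => f0; apply: (nqf) => i; rewrite f0 coef0; apply: ideal0.
apply: nqf; pose m := lead_coef f *: 'X^((size f).-1).
have qm : extend q m by move=> i; rewrite coefZ; apply: ideal_mulr.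
rewrite -(subrK m f); apply: (idealD (extend_ideal iq)) => //; apply: minf.
  by apply: (idealB iP) => //; apply: (extend_sub iP qP).
rewrite -[ltnRHS]prednK ?size_poly_gt0 // ltnS; apply/leq_sizeP => j.
rewrite leq_eqVlt coefB coefZ coefXn => /predU1P[<-|ltj].
  by rewrite eqxx mulr1 subrr.
rewrite gtn_eqF // mulr0 subr0 nth_default //.
by rewrite -[leqLHS]prednK ?size_poly_gt0.
Qed.

(** The fibre over q is a principal ideal domain, so it has no chain of three primes. Without
    residue field: let f and g have least degree outside q[X] in P' and P. If g were not in P',
    pseudo-dividing f by g would give a quotient in P' of lower degree than f, hence in q[X], and f
    would be in q[X]. So g is in P', and pseudo-division by g puts all of P in P'. *)
Lemma no_third_prime q P' P : is_prime_ideal q -> is_prime_ideal P' -> is_prime_ideal P ->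
  (forall b, q b -> P' b%:P) -> (forall b, P b%:P -> q b) ->
  (forall f, P' f -> P f) -> (exists f, P' f /\ ~ extend q f) ->
  forall f, P f -> P' f.
Proof.
move=> pq pP' pP qP' Pq P'P exf.
have iq := prime_ideal pq; have iP := prime_ideal pP; have iP' := prime_ideal pP'.
have [f [P'f nqf minf]] := min_lead iq iP' qP' exf.
have [|g [Pg nqg ming]] := min_lead iq iP (fun b qb => P'P _ (qP' b qb)).
  by have [h [P'h nh]] := exf; exists h; split=> //; apply: P'P.
set l := lead_coef g in nqg.
have g0 : g != 0 by apply: contra_notN nqg => /eqP g0; rewrite /l g0 lead_coef0; apply: ideal0.
have division x : P x -> exists k (h r : {poly B}), [/\ (l ^+ k)%:P * x = h * g + r, P' r, extend q r & (size r < size g)%N].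
  move=> Px; exists (Pdiv.Ring.rscalp x g), (Pdiv.Ring.rdivp x g), (Pdiv.Ring.rmodp x g).
  have E := Pdiv.ComRing.rdivp_eq g x; rewrite -mul_polyC in E.
  have sr : (size (Pdiv.Ring.rmodp x g) < size g)%N by rewrite Pdiv.Ring.ltn_rmodp.
  have qr : extend q (Pdiv.Ring.rmodp x g).
    apply: ming => //.
    rewrite -(addKr (Pdiv.Ring.rdivp x g * g) (Pdiv.Ring.rmodp x g)) -E addrC.
    by apply: (idealB iP); apply: ideal_mull.
  by split=> //; apply: (extend_sub iP' qP').
have P'g : P' g.
  apply: contrapT => nP'g; have [k [h [r [E P'r qr sr]]]] := division f (P'P f P'f).
  have P'h : P' h.
    have /(primeM pP')[]// : P' (h * g).
    by apply: (idealDr iP' P'r); rewrite -E; apply: ideal_mull.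
  have sg : (1 < size g)%N.
    rewrite ltnNge; apply/negP => /size1_polyC gE; apply: nqg; apply: Pq.
    by rewrite /l gE lead_coefC -gE.
  have lk0 : (l ^+ k) != 0 by rewrite expf_neq0 // lead_coef_eq0.
  have [h0|nh0] := eqVneq h 0.
    apply: nqf; move: E (qr (size f).-1); rewrite h0 mul0r add0r => <-; rewrite coefCM.
    by move=> /(primeM pq)[/(primeX pq)|].
  have sh : (size h < size f)%N.
    have shg : (size (h * g)%R <= size f)%N.
      rewrite -[h * g](addrK r) -E; apply: leq_trans (size_polyD _ _) _.
      rewrite size_polyN geq_max size_Cmul // leqnn /=.
      apply: leq_trans (ltnW sr) _; rewrite leqNgt; apply/negP => /(ming f (P'P f P'f)).
      by move=> /(_ (size f).-1).
    apply: leq_trans shg; rewrite size_mul //.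
    by case: (size g) sg => [|[|n]] // _; rewrite !addnS /= -addSn leq_addr.
  have qh := minf h P'h sh.
  have : extend q ((l ^+ k)%:P * f).
    rewrite E; have ieq := extend_ideal iq.
    by apply: (idealD ieq) => //; apply: (ideal_mulr _ ieq).
  by move=> /(_ (size f).-1); rewrite coefCM => /(primeM pq)[/(primeX pq)|].
move=> x /division[k [h [r [E P'r _ _]]]].
have : P' ((l ^+ k)%:P * x) by rewrite E; apply: idealD => //; apply: ideal_mull.
by move=> /(primeM pP')[|//]; rewrite polyC_exp => /(primeX pP') /P'P /Pq.
Qed.
Hypothesis noethB : noetherian B.

(** Were no prime strictly between q' and q, then q[X] would be minimal over q'[X] + (a) for any a
    in q outside q', and the principal ideal theorem would exclude P'. *)
Lemma prime_between q' q P' : is_prime_ideal q' -> is_prime_ideal q -> is_prime_ideal P' ->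
  (forall b, q' b -> q b) -> (exists b, q b /\ ~ q' b) ->
  (forall f, extend q' f -> P' f) -> (exists f, P' f /\ ~ extend q' f) ->
  (forall f, P' f -> extend q f) -> (exists f, extend q f /\ ~ P' f) ->
  exists q'', [/\ is_prime_ideal q'', (forall b, q' b -> q'' b), (forall b, q'' b -> q b),
    (exists b, q'' b /\ ~ q' b) & (exists b, q b /\ ~ q'' b)].
Proof.
move=> pq' pq pP' q'q [a [qa nq'a]] q'P' [f [P'f nf]] P'q strict.
have iq := prime_ideal pq; have iq' := prime_ideal pq'.
have extC r b : is_ideal r -> r b -> extend r b%:P.
  by move=> ir rb i; rewrite coefC; case: ifP => // _; apply: ideal0.
apply: contrapT => nbetween; apply: nf.
apply: (principal_ideal_theorem (hilbert_basis noethB) (extend_prime pq) (extend_prime pq')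
  (a := a%:P)) P'f => //; first exact: extC.
move=> Q pQ q'Q Qa Qq; have iQ := prime_ideal pQ.
have cq b : contract Q b -> q b by move=> /Qq/(_ 0%N); rewrite coefC.
apply: (extend_sub iQ) => b qb; apply: contrapT => nQb; apply: nbetween.
exists (contract Q); split=> //; first exact: contract_prime.
- by move=> c q'c; apply: q'Q; apply: extC.
- by exists a.
- by exists b.
Qed.

(* In terms of heights: ht P <= ht (contract P) + 1, and ht P <= ht (contract P) when P is
   extended from B. *)
Lemma poly_chain m J c P : chain_over J m c P ->
  ((forall f, P f -> extend (contract P) f) ->
    exists c', chain_over (contract J) m c' (contract P)) /\
  (forall m', m = m'.+1 -> exists c', chain_over (contract J) m' c' (contract P)).
Proof.
elim: m c P => [|m IH] c P chP; have pP := chain_over_prime chP.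
  have pq := contract_prime pP; split=> // _; exists (fun=> contract P); split=> //.
  by move=> b; case: chP => _ Jc cP; move=> /Jc/cP.
have chP' := chain_over_belast chP.
set P' := c m in chP'; have pP' := chain_over_prime chP'.
have [[pc inc] Jc cP] := chP.
have [P'P0 [f0 [cf0 nf0]]] := inc m (ltnSn m).
have P'P f : P' f -> P f by move=> /P'P0/cP.
have Pf0 : P f0 by apply/cP.
set q := contract P; set q' := contract P'.
have pq : is_prime_ideal q := contract_prime pP.
have pq' : is_prime_ideal q' := contract_prime pP'.
have q'q b : q' b -> q b by apply: P'P.
have extq' f : extend q' f -> P' f by apply: extend_sub => //; apply: prime_ideal.
have [IHe IHs] := IH c P' chP'.
(* Equal contractions: P' is then extended, so its chain contracts without loss, while P is not
   extended and may lose one. *)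
have [qq'|/existsNP[b /not_implyP[qb nq'b]]] := pselect (forall b, q b -> q' b).
  have P'e f : P' f -> extend q' f.
    apply: contraPP => nf P'f; apply: nf0.
    apply: (@no_third_prime q' P' P) => //.
    by exists f.
  have [c' c'P] := IHe P'e.
  have {}c'P : chain_over (contract J) m c' q by apply: chain_over_eq c'P => b; split; [apply: q'q|apply: qq'].
  split=> [Pe|m' [<-]]; last by exists c'.
  by case: nf0; apply: extq' => i; apply: qq'; apply: Pe.
have exb : exists b, q b /\ ~ q' b by exists b.
have rcons k c' : chain_over (contract J) k c' q' -> exists c', chain_over (contract J) k.+1 c' q.
  by move=> ch; apply: chain_over_rcons ch pq q'q exb.
have [P'e|/existsNP[f /not_implyP[P'f nf]]] := pselect (forall f, P' f -> extend q' f).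
  have [c' /rcons[c2 c2P]] := IHe P'e; split=> [_|m' [<-]]; first by exists c2.
  exact: chain_over_behead c2P.
have [m0|[m2 mE]] : m = 0%N \/ exists m2, m = m2.+1 by case: (m) => [|m2]; [left|right; exists m2].
  have [c1 c1P] : exists c1, chain_over (contract J) 0 c1 q'.
    exists (fun=> q'); split=> //.
    by move=> x /Jc; rewrite /q' /contract /P' m0.
  have [c2 c2P] := rcons _ _ c1P; rewrite m0; split=> [_|m' [<-]]; first by exists c2.
  exact: chain_over_behead c2P.
have [c1 c1P] := IHs m2 mE.
have [c2 c2P] := rcons _ _ c1P; rewrite mE; split=> [Pe|m' [<-]]; last by exists c2.
(* The chain ending in P' lost one prime on contraction; when P is extended, a prime inserted
   between q' and q makes up for it. *)
have [|||q'' [pq'' q'q'' q''q ex1 ex2]] := @prime_between q' q P' pq' pq pP' q'q exb extq'.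
- by exists f.
- by move=> g /P'P/Pe.
- by exists f0; split=> //; apply: Pe.
have [c3 c3P] := chain_over_rcons c1P pq'' q'q'' ex1.
exact: chain_over_rcons c3P pq q''q ex2.
Qed.

End PolyPrimes.

(** * Dimension of finitely generated extensions *)

Section Factor.
Variables (A B C : nzRingType) (F : {rmorphism A -> C}) (h : {rmorphism B -> C}).
Hypotheses (injF : injective F) (imh : forall b, exists a, F a = h b).

Let g b := sval (cid (imh b)).
Let gE b : F (g b) = h b. Proof. exact: svalP (cid (imh b)). Qed.

Let g_zmod : zmod_morphism g.
Proof. by move=> x y; apply: injF; rewrite rmorphB !gE rmorphB. Qed.

Let g_monoid : monoid_morphism g.
Proof. by split=> [|x y]; apply: injF; rewrite ?rmorph1 ?rmorphM !gE ?rmorph1 ?rmorphM. Qed.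

HB.instance Definition _ := GRing.isZmodMorphism.Build B A g g_zmod.
HB.instance Definition _ := GRing.isMonoidMorphism.Build B A g g_monoid.

(** A is known only through an embedding into R[t] or its fraction field; morphisms into A are
    lifted along that embedding. *)
Lemma factor_rmorphism : exists g' : {rmorphism B -> A}, forall b, F (g' b) = h b.
Proof. by exists g. Qed.

End Factor.

Section Pullback.
Variables (B A : comNzRingType) (h : {rmorphism B -> A}).
Implicit Types (J Q : A -> Prop).

Lemma preimage_ideal J : is_ideal J -> is_ideal (fun b => J (h b)).
Proof.
move=> iJ; split=> [|x y|r x]; first by rewrite rmorph0; apply: ideal0.
  by rewrite rmorphD; apply: idealD.
by rewrite rmorphM; apply: ideal_mull.
Qed.

Lemma preimage_prime Q : is_prime_ideal Q -> is_prime_ideal (fun b => Q (h b)).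
Proof.
move=> pQ; split; first by apply: preimage_ideal; apply: prime_ideal.
  by rewrite rmorph1; apply: prime1.
by move=> x y; rewrite rmorphM; apply: primeM.
Qed.

Hypothesis surj_h : forall a, exists b, h b = a.

Lemma surjective_noetherian : noetherian B -> noetherian A.
Proof.
move=> noethB J iJ incJ.
have [n|n x|N stab] := noethB (fun n b => J n (h b)).
- exact: preimage_ideal.
- exact: incJ.
by exists N => n leNn a; have [b <-] := surj_h a; apply: stab.
Qed.

Lemma preimage_chain J n c Q : chain_over J n c Q ->
  chain_over (fun b => J (h b)) n (fun i b => c i (h b)) (fun b => Q (h b)).
Proof.
move=> [[pc inc] Jc cQ]; split=> [|b|b]; [|exact: Jc|exact: cQ].
split=> i lein; first by apply: preimage_prime; apply: pc.
have [ci [a [ca na]]] := inc i lein; split=> [b|]; first exact: ci.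
by have [b bE] := surj_h a; exists b; rewrite bE.
Qed.

End Pullback.

Section Dimension.
Variables (R : idomainType) (A : comNzRingType) (iota : {rmorphism {poly R} -> A}).
Hypotheses (noethR : noetherian R) (inj_iota : injective iota).
Hypothesis domA : forall x y : A, x * y = 0 -> x = 0 \/ y = 0.

Lemma zero_prime : is_prime_ideal (fun a : A => a = 0).
Proof.
by split; [exact: zero_ideal|move/eqP; rewrite oner_eq0|exact: domA].
Qed.

(** B is an iterated polynomial ring with one variable for each element of ys. Adjoining X raises
    the dimension by one, but y satisfies b y = c, so b X - c makes the new kernel strictly larger
    than the prime (ker h)[X] and the gain is lost; only the variable of R[X] counts. *)
Lemma tower (ys : seq A) :
  (forall y, y \in ys -> exists b c, b != 0 /\ iota b * y = iota c) ->
  exists (B : idomainType) (h : {rmorphism B -> A}) (g : {rmorphism R -> B}),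
    [/\ noetherian B, (forall r, h (g r) = iota r%:P),
      (forall p, exists b, h b = iota p), (forall y, y \in ys -> exists b, h b = y) &
      forall m c P, chain_over (fun b => h b = 0) m.+1 c P ->
        exists c', chain_over (fun r => iota r%:P = 0) m c' (fun r => P (g r))].
Proof.
elim: ys => [|y ys IH] algys.
  exists {poly R}, iota, polyC; split=> //; first exact: hilbert_basis.
    by move=> p; exists p.
  move=> m c P chP; have [_ /(_ m erefl)[c' c'P]] := poly_chain noethR chP.
  by exists c'.
have [|B [h [g [noethB hg himp hys hdim]]]] := IH.
  by move=> z zys; apply: algys; rewrite inE zys orbT.
have [h' h'C h'X] : exists2 h' : {rmorphism {poly B} -> A},
    forall b, h' b%:P = h b & h' 'X = y.
  exists (horner_eval y \o map_poly h) => [b|] /=; rewrite /horner_eval.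
    by rewrite map_polyC hornerC.
  by rewrite map_polyX hornerX.
exists {poly B}, h', (polyC \o g); split.
- exact: hilbert_basis.
- by move=> r; exact: etrans (h'C _) (hg r).
- by move=> p; have [b bE] := himp p; exists b%:P; rewrite h'C.
- move=> z; rewrite inE => /predU1P[->|/hys[b bE]]; first by exists 'X.
  by exists b%:P; rewrite h'C.
move=> m c P chP.
have pker : is_prime_ideal (fun b => h b = 0) := preimage_prime h zero_prime.
have iker' : is_ideal (fun f => h' f = 0) := preimage_ideal h' (prime_ideal zero_prime).
have [|||c1 c1P] := chain_over_cons (J' := extend (fun b => h b = 0)) chP (extend_prime pker).
- by [].
- by apply: extend_sub => // b hb; rewrite h'C.
- have [|b [d [b0 bd]]] := algys y; first by rewrite mem_head.
  have [[b' b'E] [d' d'E]] := (himp b, himp d).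
  exists (b'%:P * 'X - d'%:P); split.
    by rewrite rmorphB rmorphM /= !h'C h'X b'E d'E bd subrr.
  move=> /(_ 1%N); rewrite coefB coefCM coefX coefC mulr1 subr0 b'E.
  by move=> /eqP; rewrite -(rmorph0 iota) (inj_eq inj_iota) (negPf b0).
have [_ /(_ m.+1 erefl)[c2 [pc2 kc2 c2P]]] := poly_chain noethB c1P.
apply: (hdim m c2 (contract P)); split; [exact: pc2| |exact: c2P].
by move=> b hb; apply: kc2 => i; rewrite coefC; case: ifP => // _; rewrite rmorph0.
Qed.

Variable ys : seq A.
Hypothesis alg_ys : forall y, y \in ys -> exists b c, b != 0 /\ iota b * y = iota c.
(** Generation of A by iota and ys, phrased through test maps so that it applies directly to the
    ring B of [tower]. *)
Hypothesis gen_ys : forall (B : idomainType) (h : {rmorphism B -> A}),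
  (forall p, exists b, h b = iota p) -> (forall y, y \in ys -> exists b, h b = y) ->
  forall a, exists b, h b = a.

Lemma generated_noetherian : noetherian A.
Proof.
have [B [h [g [noethB _ hp hy _]]]] := tower alg_ys.
exact: surjective_noetherian (gen_ys hp hy) noethB.
Qed.

Lemma generated_chain m c P : chain_over (fun a : A => a = 0) m.+1 c P ->
  exists c', chain_over (fun r => iota r%:P = 0) m c' (fun r => P (iota r%:P)).
Proof.
have [B [h [g [_ hg hp hy hdim]]]] := tower alg_ys.
move=> /(preimage_chain (gen_ys hp hy)) /hdim[c' c'P]; exists c'.
by apply: chain_over_eq c'P => r; rewrite hg.
Qed.

End Dimension.

(** * Matrices over domains *)

Lemma kronecker_ord (C : comNzRingType) T k J a (b : 'I_k -> C) : noetherian C ->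
  mult_closed T -> is_ideal J ->
  (forall c Q, chain_over J k c Q -> exists x, Q x /\ T x) ->
  exists x : 'I_k -> C, forall Q, is_prime_ideal Q -> (forall y, J y -> Q y) ->
    (forall y, Q y -> ~ T y) -> (forall i, Q (b i + a * x i)) -> Q a.
Proof.
move=> noethC mT iJ dimC.
pose b' i := if insub i is Some j then b j else 0.
have [x xP] := kronecker noethC a b' mT iJ dimC.
exists (fun i => x i) => Q pQ JQ QT Qb; apply: xP => // i ltik.
by have := Qb (Ordinal ltik); rewrite /b' insubT.
Qed.

Section DomainMatrices.
Variable A : comNzRingType.
Hypothesis domA : forall x y : A, x * y = 0 -> x = 0 \/ y = 0.

Lemma scalemx_inj0 m n (a : A) (M : 'M[A]_(m, n)) : a != 0 -> a *: M = 0 -> M = 0.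
Proof.
move=> /eqP a0 /matrixP aM; apply/matrixP => i j.
by have := aM i j; rewrite !mxE => /domA[].
Qed.

Lemma scalemx_inj m n (a : A) : a != 0 -> injective ( *:%R a : 'M[A]_(m, n) -> _).
Proof.
move=> a0 M N /eqP; rewrite -subr_eq0 -scalerBr => /eqP/(scalemx_inj0 a0)/eqP.
by rewrite subr_eq0 => /eqP.
Qed.

Lemma tall_matrix_kernel m k (X : 'M[A]_(m, k)) : (k < m)%N ->
  exists c : 'rV[A]_m, c != 0 /\ c *m X = 0.
Proof.
elim: k m X => [|k IH] [//|m] X ltkm.
  exists (delta_mx 0 0); split; last by apply/matrixP => i [].
  by apply/eqP => /matrixP/(_ 0 0); rewrite !mxE !eqxx => /eqP; rewrite oner_eq0.
have [X0|/existsNP[i0 /eqP x0]] := pselect (forall i, X i ord0 = 0).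
  have [c [c0 cX]] := IH m.+1 (col' ord0 X) (ltnW ltkm).
  exists c; split=> //; apply/matrixP => i j; rewrite !mxE.
  case: (unliftP ord0 j) => [j' ->|->].
    have /matrixP/(_ i j') := cX; rewrite !mxE; apply: etrans.
    by apply: eq_bigr => l _; rewrite !mxE.
  by rewrite big1 // => l _; rewrite X0 mulr0.
set x := X i0 ord0 in x0.
pose X' := \matrix_(i < m, j < k) (x * X (lift i0 i) (lift ord0 j)
  - X (lift i0 i) ord0 * X i0 (lift ord0 j)).
have [c' [c'0 c'X]] := IH m X' ltkm.
(* Elimination without fractions: X' has the rows x X_i - X_i0 X_{i0} outside the pivot row, and the
   entry of c at i0 collects the coefficients of the pivot row. *)
pose c := \row_i (if unlift i0 i is Some i' then x * c' 0 i'
  else - \sum_(i' < m) c' 0 i' * X (lift i0 i') ord0).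
have cE j : (c *m X) 0 j = \sum_(i' < m) c' 0 i' * (x * X (lift i0 i') j
    - X (lift i0 i') ord0 * X i0 j).
  rewrite !mxE (bigD1_ord i0) //= !mxE unlift_none mulNr mulr_suml addrC -sumrB.
  by apply: eq_bigr => i _; rewrite mxE liftK; ring.
exists c; split.
  apply: contra_neq c'0 => c0; apply/matrixP => i j; rewrite !mxE ord1.
  have /matrixP/(_ 0 (lift i0 j)) := c0; rewrite !mxE liftK => /domA[/eqP|//].
  by rewrite (negPf x0).
apply/matrixP => i j; rewrite ord1 cE mxE; case: (unliftP ord0 j) => [j' ->|->].
  have /matrixP/(_ 0 j') := c'X; rewrite !mxE; apply: etrans.
  by apply: eq_bigr => l _; rewrite !mxE.
by rewrite big1 // => l _; rewrite [X _ ord0 * _]mulrC subrr mulr0.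
Qed.

End DomainMatrices.

Lemma det_add (A : comNzRingType) n (M N : 'M[A]_n) :
  \det (M + N) = \sum_(J : {set 'I_n}) \det (\matrix_(i, j) if i \in J then M i j else N i j).
Proof.
rewrite /determinant exchange_big /=; apply: eq_bigr => s _.
rewrite -mulr_sumr; congr (_ * _).
under eq_bigr do rewrite mxE.
rewrite bigA_distr; apply: eq_bigr => J _.
by apply: eq_bigr => i _; rewrite mxE.
Qed.

(** Over the principal ideal domain Frac(R)[X] the row space of N is free with basis D, and s is a
    common denominator. Induction on the columns: some combination w of rows has a nonzero first
    entry x of least degree, and pseudo-division shows that x divides the first column up to a power
    of its leading coefficient. *)
Lemma poly_row_basis (R : idomainType) m n (N : 'M[{poly R}]_(m, n)) :
  exists r (C : 'M_(m, r)) (D : 'M_(r, n)) (G : 'M_(r, m)) (s : R),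
    [/\ s != 0, s%:P *: N = C *m D, s%:P *: D = G *m N &
      forall a : 'rV_r, a *m D = 0 -> a = 0].
Proof.
elim: n N => [|n IH] N.
  exists 0%N, 0, 0, 0, 1; split; rewrite ?oner_neq0 //; try by apply/matrixP => i [].
  by move=> a _; apply/matrixP => i [].
rewrite -[n.+1]/(1 + n)%N in N *.
have [c0|nc0] := eqVneq (lsubmx N) 0.
  have [r [C [D [G [s [s0 NE DE Dfree]]]]]] := IH (rsubmx N).
  exists r, C, (row_mx 0 D), G, s; split=> //.
  - by rewrite mul_mx_row mulmx0 -NE -[in LHS](hsubmxK N) c0 scale_row_mx scaler0.
  - by rewrite scale_row_mx scaler0 DE -[in RHS](hsubmxK N) c0 mul_mx_row mulmx0.
  - by move=> a; rewrite mul_mx_row mulmx0 => /eqP; rewrite row_mx_eq0 => /andP[_ /eqP/Dfree].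
pose lead (w : 'rV_m) := (w *m lsubmx N) 0 0.
have ex : exists k, `[< exists w, lead w != 0 /\ size (lead w) = k >].
  have [i i0] : exists i, lsubmx N i 0 != 0.
    apply: contrapT => ni; case/eqP: nc0; apply/matrixP => i j; rewrite ord1 [RHS]mxE.
    by apply: contrapT => /eqP nij; apply: ni; exists i.
  exists (size (lsubmx N i 0)); apply/asboolP; exists (delta_mx 0 i).
  by rewrite /lead -rowE mxE.
have [k /asboolP[w [w0 wk]] mink] := ex_minnP ex.
have minw w' : (size (lead w') < size (lead w))%N -> lead w' = 0.
  move=> lt; apply/eqP; apply: contraLR lt => w'0; rewrite -leqNgt wk.
  by apply: mink; apply/asboolP; exists w'.
set x := lead w in w0 wk minw; pose l := lead_coef x.
have l0 : l != 0 by rewrite lead_coef_eq0.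
have divx i : exists K q, (l ^+ K)%:P * lsubmx N i 0 = q * x.
  have E := Pdiv.ComRing.rdivp_eq x (lsubmx N i 0); rewrite -mul_polyC in E.
  exists (Pdiv.Ring.rscalp (lsubmx N i 0) x), (Pdiv.Ring.rdivp (lsubmx N i 0) x).
  move: E; set K := Pdiv.Ring.rscalp _ _; set q := Pdiv.Ring.rdivp _ _ => E.
  rewrite E; set rho := Pdiv.Ring.rmodp _ _ in E *.
  suff -> : rho = 0 by rewrite addr0.
  pose w' := (l ^+ K)%:P *: delta_mx 0 i - q *: w.
  have rE : lead w' = rho.
    transitivity ((l ^+ K)%:P * lsubmx N i 0 - q * x); last by rewrite E addrC addKr.
    by rewrite /x /lead mulmxBl -!scalemxAl -rowE !mxE.
  by rewrite -rE; apply: minw; rewrite rE Pdiv.Ring.ltn_rmodp.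
have [K [q qE]] : exists K (q : 'cV_m), (l ^+ K)%:P *: lsubmx N = q *m (w *m lsubmx N).
  pose Kf i := sval (cid (divx i)); have Kq i := svalP (cid (divx i)).
  pose qf i := sval (cid (Kq i)); have qP i := svalP (cid (Kq i)).
  exists (\sum_i Kf i)%N, (\col_i ((l ^+ (\sum_(j | j != i) Kf j))%:P * qf i)).
  have -> : w *m lsubmx N = x%:M by apply/matrixP => i j; rewrite !ord1 [RHS]mxE.
  apply/matrixP => i j; rewrite ord1 mul_mx_scalar [LHS]mxE [RHS]mxE [in RHS]mxE.
  rewrite (bigD1 i) //= exprD polyCM.
  have qPi : (l ^+ Kf i)%:P * lsubmx N i 0 = qf i * x := qP i.
  by rewrite mulrAC qPi mulrAC [RHS]mulrC; congr (_ * _); exact: mulrC.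
pose c := lsubmx N; rewrite -/c in nc0 qE.
set N2 := rsubmx N; pose P := (l ^+ K)%:P : {poly R}.
have NE0 : N = row_mx c N2 by rewrite hsubmxK.
(* Subtracting q (w N) from P N clears the first column; these are the remaining columns. *)
have [r [C [D [G [s [s0 NE DE Dfree]]]]]] := IH (P *: N2 - q *m (w *m N2)).
exists (1 + r)%N, (row_mx (s%:P *: q) C), (col_mx (w *m N) (row_mx 0 D)),
  (col_mx ((s * l ^+ K)%:P *: w) (G *m (P *: (P%:M - q *m w)))), (s * l ^+ K).
split.
- by rewrite mulf_neq0 // expf_neq0.
- rewrite mul_row_col mul_mx_row mulmx0 -NE NE0 mul_mx_row polyCM -/P.
  rewrite mul_mx_row add_row_mx addr0 -!scalemxAl -qE -scalerDr addrC subrK.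
  by rewrite scale_row_mx !scalerA.
- rewrite mul_col_mx scale_col_mx scalemxAl; congr col_mx.
  rewrite polyCM -/P mulrC -scalerA scale_row_mx scaler0 DE.
  rewrite -mulmxA -scalemxAl -scalemxAr; congr (_ *: _).
  rewrite NE0 mulmxBl mul_scalar_mx -mulmxA mul_mx_row mul_mx_row scale_row_mx.
  by rewrite opp_row_mx add_row_mx qE subrr mul_mx_row mulmx0.
- move=> a; rewrite -[a]hsubmxK mul_row_col NE0 !mul_mx_row mulmx0 add_row_mx addr0.
  move=> /eqP; rewrite row_mx_eq0 => /andP[/eqP a1 /eqP].
  have -> : lsubmx a = 0.
    apply/matrixP => i j; rewrite !ord1 [RHS]mxE.
    move/matrixP: a1 => /(_ 0 0); rewrite mxE big_ord1 -/(lead w) -/x [RHS]mxE => /eqP.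
    by rewrite mulf_eq0 (negPf w0) orbF => /eqP.
  by rewrite mul0mx add0r => /Dfree ->; rewrite row_mx0.
Qed.

Definition no_chain (C : comNzRingType) (J : C -> Prop) n :=
  forall c Q, ~ chain_over J n c Q.

(** * Idempotent matrices: unimodularity modulo one element *)

Section IdempotentMatrix.
Variables (A : comNzRingType) (n r : nat) (E : 'M[A]_n).
Hypotheses (domA : forall x y : A, x * y = 0 -> x = 0 \/ y = 0) (noethA : noetherian A).
Variables (e : 'M[A]_(r, n)) (psi : 'M[A]_(n, r)) (s : A).
Hypotheses (Epsi : E *m psi = psi) (epsi : e *m psi = s%:M) (s0 : s != 0).

(** By multilinearity these determinants add up to det (E + (1 - E)) = 1, so no prime contains them
    all; they play the role of an open cover. *)
Definition mixed (J : {set 'I_n}) : 'M[A]_n :=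
  \matrix_(i, j) if i \in J then E i j else (1%:M - E) i j.

Implicit Type J : {set 'I_n}.

Lemma mixed_row J i : i \in J -> row i (mixed J) = row i E.
Proof. by move=> iJ; apply/rowP => j; rewrite !mxE iJ. Qed.

Lemma sum_det_mixed : \sum_J \det (mixed J) = 1.
Proof. by rewrite -det_add addrC subrK det1. Qed.

(** With fewer than r rows in J, some nonzero c makes the entries of psi c^T in J vanish. This
    vector is fixed by E, so [mixed J] kills it: the rows of E by the choice of c, those of 1 - E
    because E psi = psi. Applying e psi = s shows that it is nonzero. *)
Lemma det_mixed_eq0 J : (#|J| < r)%N -> \det (mixed J) = 0.
Proof.
move=> ltJr; pose X := (rowsub (enum_val (A := J)) psi)^T.
have [c [/negP c0 cX]] := tall_matrix_kernel domA X ltJr.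
have Mc : mixed J *m (psi *m c^T) = 0.
  apply/matrixP => i j; rewrite ord1 [RHS]mxE.
  have [iJ|niJ] := boolP (i \in J).
    transitivity ((row i (mixed J) *m (psi *m c^T)) 0 0); first by rewrite -row_mul [RHS]mxE.
    rewrite mixed_row // -row_mul mulmxA Epsi mxE.
    have /matrixP/(_ 0 (enum_rank_in iJ i)) := cX; rewrite mxE [RHS]mxE; apply: etrans.
    rewrite mxE; apply: eq_bigr => k _; rewrite !mxE enum_rankK_in // mulrC //.
  transitivity ((row i (mixed J) *m (psi *m c^T)) 0 0); first by rewrite -row_mul [RHS]mxE.
  have -> : row i (mixed J) = row i (1%:M - E) by apply/rowP => j'; rewrite !mxE (negPf niJ).
  by rewrite -row_mul mulmxA mulmxBl mul1mx Epsi subrr mul0mx !mxE.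
have : (s * \det (mixed J)) *: c^T = 0.
  have sE : s *: c^T = e *m (psi *m c^T) by rewrite mulmxA epsi mul_scalar_mx.
  rewrite mulrC -scalerA sE scalemxAr -mul_scalar_mx -mul_adj_mx.
  by rewrite -[_ *m _ *m (psi *m _)]mulmxA Mc !mulmx0.
move=> sc; apply: contrapT => /eqP d0; apply: c0.
have: s * \det (mixed J) != 0 by apply/eqP => /domA[/eqP|/eqP]; rewrite ?(negPf s0) ?(negPf d0).
by move=> /(scalemx_inj0 domA)/(_ sc)/eqP; rewrite trmx_eq0.
Qed.

(* On the locus where det (mixed J) is invertible, the rows E_j with j in J split off a free
   summand, with dual basis given by the columns of the adjugate; one such locus is treated
   at a time. *)
Lemma unimodular_mod (t : A) : no_chain (adjoin (fun x => x = 0) t) r ->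
  exists p : 'rV[A]_n, forall Q, is_prime_ideal Q -> Q t ->
    ~ (forall y : 'cV_n, Q ((p *m E *m y) 0 0)).
Proof.
move=> dimA; pose I := adjoin (fun x : A => x = 0) t.
have iI : is_ideal I := adjoin_ideal t (zero_ideal A).
have tI Q : is_prime_ideal Q -> Q t -> forall x, I x -> Q x.
  by move=> /prime_ideal iQ Qt x [c /eqP]; rewrite subr_eq0 => /eqP->; apply: ideal_mull.
suff [p pP] : exists p : 'rV[A]_n, forall Q, is_prime_ideal Q -> Q t ->
    (forall y : 'cV_n, Q ((p *m E *m y) 0 0)) ->
    forall J, J \in enum {: {set 'I_n}} -> Q (\det (mixed J)).
  exists p => Q pQ Qt Qp; apply: (prime1 pQ); rewrite -sum_det_mixed.
  by apply: (ideal_sum (prime_ideal pQ)) => J _; apply: (pP Q) => //; rewrite mem_enum.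
elim: (enum _) => [|J l [p pP]]; first by exists 0.
have [d0|d0] := eqVneq (\det (mixed J)) 0.
  exists p => Q pQ Qt Qp J'; rewrite inE => /predU1P[->|]; last exact: pP.
  by rewrite d0; exact: ideal0 (prime_ideal pQ).
have leJ : (r <= #|J|)%N by rewrite leqNgt; apply: contra_neqN d0; apply: det_mixed_eq0.
set nu := \det (mixed J) in d0 *; pose Y := \adj (mixed J).
have EY i j : i \in J -> (E *m Y) i j = nu *+ (i == j).
  move=> iJ; transitivity ((row i E *m Y) 0 j); first by rewrite -row_mul [RHS]mxE.
  by rewrite -(mixed_row iJ) -row_mul mul_mx_adj !mxE.
have mT : mult_closed (fun x : A => x = 1) by split=> // x y -> ->; rewrite mulr1.
(* One factor nu because p moves by nu X, which preserves modulo nu what was achieved for the sets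
   in l; the other because E Y is nu times the identity on the rows in J. *)
have [c Q|x xP] := kronecker_ord (nu ^+ 2) (fun i => (p *m E *m Y) 0 (enum_val i : 'I_n))
  noethA mT iI (k := #|J|).
  by move=> /(chain_over_shorten leJ)[c' /dimA].
pose X : 'rV[A]_n := \sum_k x k *: delta_mx 0 (enum_val k).
have XE : X *m E *m Y = \sum_k x k *: row (enum_val k) (E *m Y).
  rewrite -mulmxA mulmx_suml; apply: eq_bigr => k _.
  by rewrite -scalemxAl -rowE.
have XEY k : (X *m E *m Y) 0 (enum_val k) = nu * x k.
  rewrite XE summxE (bigD1 k) //= big1 ?addr0 => [|k' nek].
    by rewrite mxE [X in _ * X]mxE EY ?enum_valP // eqxx mulr1n mulrC.
  by rewrite mxE [X in _ * X]mxE EY ?enum_valP // (inj_eq enum_val_inj) (negPf nek) mulr0.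
exists (p + nu *: X) => Q pQ Qt Qp; have iQ := prime_ideal pQ.
have Qnu : Q nu.
  apply: (primeX (n := 2) pQ); apply: (xP Q pQ) => [y /(tI Q pQ Qt)//|y Qy y1|k].
    by apply: (prime1 pQ); rewrite -y1.
  have := Qp (col (enum_val k) Y); rewrite colE mulmxA -colE mxE !mulmxDl -!scalemxAl.
  by rewrite mxE [X in _ + X]mxE XEY mulrA expr2.
move=> J'; rewrite inE => /predU1P[-> //|]; apply: pP => // y.
have := Qp y; rewrite !mulmxDl -!scalemxAl mxE [X in _ + X]mxE; apply: (idealDr iQ).
exact: ideal_mulr.
Qed.

End IdempotentMatrix.

(** * Unimodular elements *)

Section Substitution.
Variable R : comNzRingType.
Implicit Type h : {poly R}.

Lemma poly_const_decomp h : exists w, h = (h.[0])%:P + 'X * w.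
Proof.
elim/poly_ind: h => [|h c _]; first by exists 0; rewrite horner0 mulr0 addr0.
by exists h; rewrite hornerMXaddC mulr0 add0r addrC mulrC.
Qed.

Lemma comp_scaleX_near1 h (lam : R) :
  exists w, h \Po ((1 - lam)%:P * 'X) = h + lam%:P * ('X * w).
Proof.
elim/poly_ind: h => [|h c [w hw]]; first by exists 0; rewrite comp_poly0 !mulr0 addr0.
exists ((1 - lam)%:P * ('X * w) - h); rewrite comp_polyD comp_polyM comp_polyX comp_polyC hw.
by rewrite polyCB polyC1; ring.
Qed.

Lemma comp_scaleX_near0 h (mu : R) :
  exists w, h \Po (mu%:P * 'X) = (h.[0])%:P + mu%:P * w.
Proof.
have [w hE] := poly_const_decomp h; exists ('X * (w \Po (mu%:P * 'X))).
by rewrite {1}hE comp_polyD comp_polyM comp_polyX comp_polyC; ring.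
Qed.

End Substitution.

(** * Patching the element modulo s with its coordinates over A_s *)

Section Splitting.
Variables (R : idomainType) (d : nat) (A : comNzRingType) (iota : {rmorphism {poly R} -> A}).
Hypotheses (noethR : noetherian R) (noethA : noetherian A) (inj_iota : injective iota).
Hypothesis domA : forall x y : A, x * y = 0 -> x = 0 \/ y = 0.
Hypothesis dimR : forall c, ~ prime_chain (R := R) d.+1 c.

Definition near_one (s : R) (u : R) := exists i r, u = s ^+ i * (1 + s * r).

Lemma near_one_mult s : mult_closed (near_one s).
Proof.
split; first by exists 0%N, 0; rewrite expr0 mulr0 addr0 mulr1.
move=> _ _ [i [r ->]] [j [t ->]]; exists (i + j)%N, (r + t + s * r * t).
by rewrite exprD; ring.
Qed.

(* A maximal ideal cannot avoid both s and 1 + sR, so the localization of R at near_one s has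
   dimension < d. *)
Lemma poly_chain_near_one s k c Q : (d < k)%N ->
  chain_over (fun f : {poly R} => f = 0) k c Q -> exists r, Q r%:P /\ near_one s r.
Proof.
move=> ltdk /(chain_over_shorten ltdk)[c1 c1P]; apply: contrapT => nQ.
have pQ := chain_over_prime c1P.
have [_ /(_ d erefl)[c2 c2P]] := poly_chain noethR c1P.
have pq := contract_prime pQ; set q := contract Q in c2P pq; have iq := prime_ideal pq.
have nqs : ~ q s.
  by move=> qs; apply: nQ; exists s; split=> //; exists 1%N, 0; rewrite mulr0 addr0 mulr1.
have [|q2 [pq2 q2q]] := exists_prime_ge noethR (adjoin_ideal s iq).
  move=> [r qr]; apply: nQ; exists (1 - r * s); split=> //; exists 0%N, (- r).
  by rewrite expr0 mul1r mulrN mulrC.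
have [||c3 [pc3 _ _]] := chain_over_rcons c2P pq2.
- by move=> x qx; apply: q2q; apply: adjoinl.
- by exists s; split=> //; apply: q2q; apply: adjoinr.
exact: dimR pc3.
Qed.

Lemma one_mult (C : comNzRingType) : mult_closed (fun x : C => x = 1).
Proof. by split=> // x y -> ->; rewrite mulr1. Qed.

Lemma unimodular_lift n r (E : 'M[A]_n) (e : 'M_(r, n)) (psi : 'M_(n, r)) (s : R)
    (p : 'rV[A]_n) (g : 'rV[{poly R}]_r) :
  (d < r)%N -> E *m psi = psi -> e *m psi = (iota s%:P)%:M ->
  p *m psi = map_mx iota g ->
  (forall Q, is_prime_ideal Q -> Q (iota s%:P) ->
    ~ forall y : 'cV_n, Q ((p *m E *m y) 0 0)) ->
  exists (x : 'rV_n) (y : 'cV_n), (x *m E *m y) 0 0 = 1.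
Proof.
move=> ltdr Epsi epsi pg pmod.
(* Adjusts the constant terms, so that a prime of R containing all of them contains s. *)
have [c Q|y0 y0P] := kronecker_ord (k := r) (s ^+ 2) (fun i => (g 0 i).[0]) noethR
  (one_mult R) (zero_ideal R).
  by move=> /(chain_over_shorten ltdr)[c' [pc' _ _]]; case: (dimR pc').
pose h1 i := g 0 i + (s ^+ 2 * y0 i)%:P.
have h10 q : is_prime_ideal q -> (forall i, q (h1 i).[0]) -> q s.
  move=> pq qh; apply: (primeX (n := 2) pq); apply: (y0P q pq) => [y ->|y qy y1|i].
  - exact: ideal0 (prime_ideal pq).
  - by apply: (prime1 pq); rewrite -y1.
  - by have := qh i; rewrite /h1 hornerD hornerC.
pose T (f : {poly R}) := exists2 u, near_one s u & f = u%:P.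
have mT : mult_closed T.
  have [T1 TM] := near_one_mult s; split; first by exists 1.
  by move=> _ _ [u nu ->] [v nv ->]; exists (u * v); rewrite ?polyCM //; apply: TM.
have noethRX := hilbert_basis noethR.
(* The factor X in the multiplier protects the constant terms just arranged. *)
have [c Q|y1 y1P] := kronecker_ord (k := r) ((s ^+ 2)%:P * 'X) h1 noethRX
  mT (zero_ideal {poly R}).
  by move=> /(poly_chain_near_one s ltdr)[u [Qu nu]]; exists u%:P; split=> //; exists u.
pose h i := h1 i + (s ^+ 2)%:P * 'X * y1 i.
have h0 i : (h i).[0] = (h1 i).[0] by rewrite /h hornerD !hornerM hornerX mulr0 mul0r addr0.
pose I f := exists c : 'I_r -> {poly R}, f = \sum_i c i * h i.
have iI : is_ideal I.
  split; first by exists (fun=> 0); rewrite big1 // => i _; rewrite mul0r.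
    move=> _ _ [c ->] [c' ->]; exists (fun i => c i + c' i).
    by rewrite -big_split; apply: eq_bigr => i _; rewrite mulrDl.
  move=> a _ [c ->]; exists (fun i => a * c i).
  by rewrite mulr_sumr; apply: eq_bigr => i _; rewrite mulrA.
have Ih i : I (h i).
  exists (fun j => (j == i)%:R); rewrite (bigD1 i) //= eqxx mul1r big1 ?addr0 // => j /negPf->.
  by rewrite mul0r.
(* A prime over (h) avoiding T does not contain s, so it contains X by the choice of y1, hence all
   the h(0), hence s after all. *)
have [f [[c fE] [u [m [t uE]] fu]]] : exists f, I f /\ T f.
  apply: (meets noethRX iI mT) => Q pQ IQ; apply: contrapT => nQT.
  have iQ := prime_ideal pQ.
  have nTs : ~ Q s%:P.
    move=> Qs; apply: nQT; exists s%:P; split=> //; exists s => //.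
    by exists 1%N, 0; rewrite mulr0 addr0 mulr1.
  have QX : Q 'X.
    have /(primeM pQ)[|//] : Q ((s ^+ 2)%:P * 'X).
      apply: (y1P Q pQ) => [y ->|y Qy Ty|i]; first exact: ideal0.
        by apply: nQT; exists y.
      exact/IQ/Ih.
    by rewrite polyC_exp => /(primeX pQ).
  apply: nTs; apply: (h10 (contract Q) (contract_prime pQ)) => i.
  rewrite -h0 /contract; have [w hE] := poly_const_decomp (h i).
  apply: (idealDr iQ (y := 'X * w)); first exact: ideal_mulr.
  by rewrite -hE; apply: IQ.
(* Here u = s^m v, and mu = 1 - s^2 t^2 is both a multiple of v and congruent to 1 modulo s^2. *)
pose v := 1 + s * t; pose lam := (s * t) ^+ 2; pose mu := 1 - lam.
have muE : mu = v * (1 - s * t) by rewrite /mu /lam /v; ring.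
pose w i := sval (cid (comp_scaleX_near1 (h i) lam)).
have wE i : h i \Po (mu%:P * 'X) = h i + lam%:P * ('X * w i).
  exact: svalP (cid (comp_scaleX_near1 (h i) lam)).
(* Solves s z = h(mu X) - g; every term of h(mu X) - g has the factor s^2, so z keeps a factor s. *)
pose z : 'rV[{poly R}]_r := \row_i (s%:P * ((y0 i)%:P + 'X * y1 i + (t ^+ 2)%:P * ('X * w i))).
pose p' := p + map_mx iota z *m e.
have p'psi i : (p' *m psi) 0 i = iota (h i \Po (mu%:P * 'X)).
  rewrite /p' mulmxDl pg -mulmxA epsi mul_mx_scalar !mxE -rmorphM -rmorphD; congr (iota _).
  by rewrite wE /h /h1 /lam !expr2 !polyCM; ring.
exists p'; pose O a := exists y : 'cV_n, a = (p' *m E *m y) 0 0.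
have iO : is_ideal O.
  split; first by exists 0; rewrite mulmx0 mxE.
    by move=> _ _ [y ->] [y' ->]; exists (y + y'); rewrite mulmxDr [RHS]mxE.
  by move=> a _ [y ->]; exists (a *: y); rewrite -scalemxAr [RHS]mxE.
suff [y yE] : O 1 by exists y.
apply: contrapT => nO1; have [Q [pQ OQ]] := exists_prime_ge noethA iO nO1.
have iQ := prime_ideal pQ.
have [Qs|nQs] := pselect (Q (iota s%:P)).
  apply: (pmod Q pQ Qs) => y.
  have := OQ _ (ex_intro _ y erefl); rewrite /p' !mulmxDl mxE; apply: (idealDr iQ).
  have -> : z = s%:P *: \row_i ((y0 i)%:P + 'X * y1 i + (t ^+ 2)%:P * ('X * w i)).
    by apply/rowP => i; rewrite !mxE.
  by rewrite map_mxZ -!scalemxAl mxE; apply: ideal_mulr.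
pose Q0 (f : {poly R}) := Q (iota f).
have pQ0 : is_prime_ideal Q0 := preimage_prime iota pQ.
have iQ0 := prime_ideal pQ0.
have Q0h i : Q0 (h i \Po (mu%:P * 'X)).
  rewrite /Q0 -p'psi; apply: OQ; exists (col i psi).
  by rewrite colE mulmxA -colE [RHS]mxE -mulmxA Epsi.
(* The constant u is fixed by the substitution, so u in (h) becomes u in (h(mu X)). *)
have Q0u : Q0 u%:P.
  have -> : u%:P = f \Po (mu%:P * 'X) by rewrite fu comp_polyC.
  rewrite fE rmorph_sum; apply: (ideal_sum iQ0) => i _.
  by rewrite rmorphM; exact: (ideal_mull _ iQ0 (Q0h i)).
have Q0mu : Q0 mu%:P.
  move: Q0u; rewrite uE polyCM => /(primeM pQ0)[|Qv].
    by rewrite polyC_exp => /(primeX pQ0).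
  by rewrite muE polyCM; apply: ideal_mulr.
apply: nQs; apply: (h10 (contract Q0) (contract_prime pQ0)) => i.
rewrite -h0 /contract; have [w' w'E] := comp_scaleX_near0 (h i) mu.
by have := Q0h i; rewrite w'E; apply: (idealDr iQ0); apply: ideal_mulr.
Qed.

(** Once s0 is inverted, z' has the inverse z / s0 and A becomes R_s0[v][1/z']. For v = at the
    choice is z' = a, z = 1, s0 = a; for v = 1/t it is z' = v, z = at, s0 = a. *)
Variables (z' : {poly R}) (z : A) (s0 : R).
Hypotheses (s0_neq0 : s0 != 0) (zz' : z * iota z' = iota s0%:P).
Hypothesis den : forall x, exists m f, iota (z' ^+ m) * x = iota f.
Hypothesis dimA : forall s : R, s != 0 ->
  no_chain (adjoin (fun x => x = 0) (iota s%:P)) d.+1.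

Lemma matrix_den m n (X : 'M[A]_(m, n)) :
  exists k (Y : 'M_(m, n)), iota (z' ^+ k) *: X = map_mx iota Y.
Proof.
pose K i j := sval (cid (den (X i j))); have KP i j := svalP (cid (den (X i j))).
pose k := (\sum_i \sum_j K i j)%N.
have num i j : exists f, iota (z' ^+ k) * X i j = iota f.
  have [f fE] := KP i j; exists (z' ^+ (k - K i j) * f).
  rewrite rmorphM -fE mulrA -rmorphM -exprD subnK //.
  by rewrite /k (bigD1 i) //= (bigD1 j) //= -addnA leq_addr.
exists k, (\matrix_(i, j) sval (cid (num i j))); apply/matrixP => i j; rewrite !mxE.
exact: svalP (cid (num i j)).
Qed.

Lemma iota_neq0 f : f != 0 -> iota f != 0.
Proof. by rewrite -(inj_eq inj_iota) rmorph0. Qed.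

Lemma z'_neq0 : z' != 0.
Proof.
apply/eqP => z0; move: zz'; rewrite z0 rmorph0 mulr0 => /esym/eqP; apply/negP.
by apply: iota_neq0; rewrite polyC_eq0.
Qed.

Theorem idempotent_unimodular n (E : 'M[A]_n) (V : 'M[A]_(d.+1, n)) :
  E *m E = E -> V *m E = V -> (forall c : 'rV_d.+1, c *m V = 0 -> c = 0) ->
  exists (x : 'rV_n) (y : 'cV_n), (x *m E *m y) 0 0 = 1.
Proof.
move=> EE VE Vfree.
have [m [E0 E0E]] := matrix_den E.
have [r [C [D [G [s1 [s1_neq0 CD GE Dfree]]]]]] := poly_row_basis E0.
pose e := map_mx iota D.
(* s1 comes from the basis D and s0^m from the denominator of E. The extra s0 puts s in every prime
   containing s0, which absorbs the power s0^k introduced at the end. *)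
pose s := s1 * s0 ^+ m.+1.
have s_neq0 : s != 0 by rewrite mulf_neq0 // expf_neq0.
pose psi := E *m ((iota s0%:P * z ^+ m) *: map_mx iota C).
have zz'm k : z ^+ k * iota (z' ^+ k) = iota (s0 ^+ k)%:P.
  by rewrite rmorphXn -exprMn zz' -rmorphXn polyC_exp.
have s1_iota : iota s1%:P != 0 by apply: iota_neq0; rewrite polyC_eq0.
have z'k k : iota (z' ^+ k) != 0 by apply: iota_neq0; rewrite expf_neq0 // z'_neq0.
have eE : e *m E = e.
  apply: (scalemx_inj domA s1_iota); rewrite scalemxAl /e -map_mxZ GE map_mxM -E0E.
  by rewrite -scalemxAr -scalemxAl -mulmxA EE.
have efree (a : 'rV_r) : a *m e = 0 -> a = 0.
  move=> ae; have [k [a0 a0E]] := matrix_den a.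
  apply: (scalemx_inj0 domA (z'k k)); rewrite a0E.
  suff -> : a0 = 0 by rewrite map_mx0.
  apply: Dfree; apply/matrixP => i j; apply: inj_iota.
  have /matrixP/(_ i j) : map_mx iota (a0 *m D) = 0.
    by rewrite map_mxM -a0E -scalemxAl -/e ae scaler0.
  by rewrite !mxE rmorph0.
have psie : psi *m e = iota s%:P *: E.
  rewrite /psi -mulmxA -scalemxAl -map_mxM -CD map_mxZ -E0E !scalerA -scalemxAr EE.
  congr (_ *: _).
  have -> : s%:P = s1%:P * (s0 ^+ m)%:P * s0%:P by rewrite /s exprSr !polyCM mulrA.
  by rewrite !rmorphM -zz'm; ring.
have Epsi : E *m psi = psi by rewrite /psi mulmxA EE.
(* (e psi - s) e = e (s E) - s e = 0, and the rows of e are independent. *)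
have epsi : e *m psi = (iota s%:P)%:M.
  apply/eqP; rewrite -subr_eq0; apply/eqP/row_matrixP => i; rewrite row0; apply: efree.
  by rewrite -row_mul mulmxBl -mulmxA psie -scalemxAr eE mul_scalar_mx subrr row0.
(* Otherwise c V psi = 0 for some nonzero c, and s c V = c V psi e = 0 contradicts the independence
   of the rows of V. *)
have ltdr : (d < r)%N.
  rewrite ltnNge; apply/negP => lerd; rewrite -ltnS in lerd.
  have [c [c0 cV]] := tall_matrix_kernel domA (V *m psi) lerd.
  case/eqP: c0; apply: Vfree; apply: (scalemx_inj0 domA (a := iota s%:P)).
    by apply: iota_neq0; rewrite polyC_eq0.
  rewrite -VE mulmxA scalemxAr -psie.
  by rewrite -mulmxA [V *m _]mulmxA mulmxA cV mul0mx.
have s_iota : iota s%:P != 0 by apply: iota_neq0; rewrite polyC_eq0.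
have [|p pP] := unimodular_mod domA noethA Epsi epsi s_iota (t := iota s%:P).
  by move=> c Q /(chain_over_shorten ltdr)[c' /(dimA s_neq0)].
(* Scaling psi by z'^k brings the coordinates of p into R[v]; e is scaled by z^k so that e psi
   remains a scalar from R, now s s0^k. *)
have [k [g gE]] := matrix_den (p *m psi).
apply: (@unimodular_lift n r E (z ^+ k *: e) (iota (z' ^+ k) *: psi) (s * s0 ^+ k) p g ltdr).
- by rewrite -scalemxAr Epsi.
- rewrite -scalemxAl -scalemxAr epsi scalerA zz'm scale_scalar_mx -rmorphM -polyCM.
  by rewrite mulrC.
- by rewrite -scalemxAr gE.
move=> Q pQ; rewrite polyCM rmorphM => Qs; apply: pP => //.
case/(primeM pQ): Qs => //; rewrite polyC_exp rmorphXn => /(primeX pQ) Qs0.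
by rewrite /s exprSr mulrA polyCM rmorphM; apply: ideal_mull => //; apply: prime_ideal.
Qed.

End Splitting.

(** * From idempotent matrices back to projective modules *)

Section Pairing.
Variables (A : comNzRingType) (P : lmodType A) (n : nat) (i : {linear P -> 'rV[A]_n}).
Variable y : 'cV[A]_n.

Let pairing (q : P) : A^o := (i q *m y) 0 0.

Let pairing_linear : linear pairing.
Proof. by move=> a u v; rewrite /pairing linearP mulmxDl -scalemxAl !mxE. Qed.

HB.instance Definition _ := GRing.isLinear.Build A P A^o _ pairing pairing_linear.

Lemma pairing_exists : exists phi : {linear P -> A^o}, forall q, phi q = (i q *m y) 0 0.
Proof. by exists pairing. Qed.

End Pairing.

(** The projective module is the row space of E: V lists d + 1 independent elements of it, x E is
    the unimodular element, and y is a functional taking the value 1 there. *)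
Definition splits (A : comNzRingType) d := forall n (E : 'M[A]_n) (V : 'M[A]_(d.+1, n)),
  E *m E = E -> V *m E = V -> (forall c : 'rV_d.+1, c *m V = 0 -> c = 0) ->
  exists (x : 'rV_n) (y : 'cV_n), (x *m E *m y) 0 0 = 1.

Lemma splits_unimodular (A : comNzRingType) d : splits A d ->
  forall P : lmodType A, fg_projective P -> rank_gt P d -> exists p : P, unimodular p.
Proof.
move=> splitA P [n [i [pi piK]]] [v vfree].
pose E := lin1_mx (i \o pi); pose V := \matrix_j i (v j).
have [||c cV|x [y xy]] := splitA n E V.
- by apply/row_matrixP => k; rewrite row_mul mul_rV_lin1 /= rowE mul_rV_lin1 /= piK.
- by apply/row_matrixP => k; rewrite row_mul rowK mul_rV_lin1 /= piK.
- apply/rowP => k; rewrite mxE; apply: (vfree (fun k => c 0 k)).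
  apply: (can_inj piK); rewrite linear0 linear_sum -[RHS]cV mulmx_sum_row.
  by apply: eq_bigr => j _; rewrite linearZ rowK.
exists (pi x) => a; have [phi phiE] := pairing_exists i (a *: y).
exists phi; rewrite phiE -scalemxAr mxE.
by move: xy; rewrite mul_rV_lin1 /= => ->; rewrite mulr1.
Qed.

Lemma noetherian_fg (R : comNzRingType) (I : R -> Prop) : noetherian R -> is_ideal I ->
  exists l : seq R, (forall x, x \in l -> I x) /\
    forall K, is_ideal K -> (forall x, x \in l -> K x) -> forall x, I x -> K x.
Proof.
move=> noethR iI.
pose span (l : seq R) x := forall K, is_ideal K -> (forall x, x \in l -> K x) -> K x.
have ispan l : is_ideal (span l).
  split=> [K iK _|x y lx ly K iK lK|r x lx K iK lK]; first exact: ideal0.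
    by apply: (idealD iK); [apply: lx|apply: ly].
  by apply: (ideal_mull _ iK); apply: lx.
have [|J [_ [l [lI Jl]] _ maxJ]] := noeth_max noethR
  (Pr := fun J => exists l, (forall x, x \in l -> I x) /\ forall x, J x <-> span l x) (ispan [::]).
  by exists [::].
exists l; split=> // K iK lK x Ix.
have /Jl : J x; last exact.
apply: (maxJ (span (x :: l))) => //.
- exists (x :: l); split=> // z; rewrite inE => /predU1P[->//|]; exact: lI.
- move=> z /Jl lz H iH lH; apply: lz => // u ul; apply: lH; by rewrite inE ul orbT.
- by move=> H iH lH; apply: lH; rewrite mem_head.
Qed.

Section Ipow.
Variables (R : comNzRingType) (I : R -> Prop).
Hypothesis iI : is_ideal I.

Lemma ipow_ideal k : is_ideal (ipow I k).
Proof.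
case: k => [|k]; first by split.
split.
- by exists [::]; rewrite big_nil; split.
- move=> _ _ [l [lP ->]] [l' [l'P ->]]; exists (l ++ l'); rewrite big_cat; split=> // q.
  by rewrite mem_cat => /orP[/lP|/l'P].
- move=> r _ [l [lP ->]]; exists [seq (r * q.1, q.2) | q <- l]; split.
    by move=> _ /mapP[q /lP[q1 q2] ->]; split=> //=; apply: ideal_mull.
  by rewrite big_map mulr_sumr; apply: eq_bigr => q _; rewrite mulrA.
Qed.

Lemma ipow1 x : I x -> ipow I 1 x.
Proof.
move=> Ix; exists [:: (x, 1)]; rewrite big_seq1 mulr1; split=> // q.
by rewrite inE => /eqP->.
Qed.

Lemma ipow_zero k x : (forall y, I y -> y = 0) -> ipow I k.+1 x -> x = 0.
Proof.
move=> I0 [l [lP ->]]; rewrite big_seq big1 // => q /lP[/I0-> _].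
by rewrite mul0r.
Qed.

(** Used with S the set of polynomials reached by a test map, to establish [gen_ys] from generators
    of I. *)
Lemma ipow_generated (S : {poly R} -> Prop) : S 0 -> S 1 ->
  (forall p q, S p -> S q -> S (p + q)) -> (forall p q, S p -> S q -> S (p * q)) ->
  (forall r, S r%:P) -> (forall x, I x -> S (x%:P * 'X)) ->
  forall k x, ipow I k x -> S (x%:P * 'X^k).
Proof.
move=> S0 S1 SD SM SC SX; elim=> [|k IH] x; first by rewrite expr0 mulr1.
move=> [l [lP ->]]; rewrite rmorph_sum mulr_suml big_seq.
apply: (big_ind S) => // q /lP[Iq1 Iq2].
have -> : (q.1 * q.2)%:P * 'X^(k.+1) = (q.1%:P * 'X) * (q.2%:P * 'X^k) by rewrite polyCM exprS; ring.
by apply: SM; [apply: SX|apply: IH].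
Qed.

End Ipow.

Lemma injective_domain (A : comNzRingType) (L : idomainType) (f : {rmorphism A -> L}) :
  injective f -> forall x y : A, x * y = 0 -> x = 0 \/ y = 0.
Proof.
move=> injf x y xy; have /eqP : f x * f y = 0 by rewrite -rmorphM xy rmorph0.
by rewrite mulf_eq0 => /orP[] /eqP; rewrite -(rmorph0 f) => /injf; [left|right].
Qed.

Section Generated.
Variables (R : idomainType) (d : nat) (A : comNzRingType) (iota : {rmorphism {poly R} -> A}).
Hypotheses (noethR : noetherian R) (inj_iota : injective iota).
Hypothesis domA : forall x y : A, x * y = 0 -> x = 0 \/ y = 0.
Hypothesis dimR : forall c, ~ prime_chain (R := R) d.+1 c.
Variable ys : seq A.
Hypothesis alg_ys : forall y, y \in ys -> exists b c, b != 0 /\ iota b * y = iota c.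
Hypothesis gen_ys : forall (B : idomainType) (h : {rmorphism B -> A}),
  (forall p, exists b, h b = iota p) -> (forall y, y \in ys -> exists b, h b = y) ->
  forall a, exists b, h b = a.
Variables (z' : {poly R}) (z : A) (s0 : R).
Hypotheses (s0_neq0 : s0 != 0) (zz' : z * iota z' = iota s0%:P).
Hypothesis den : forall x, exists m f, iota (z' ^+ m) * x = iota f.

(** A/sA has dimension at most d: a chain above s is prolonged downwards by the zero ideal, and
    contracting a chain of A to R costs at most one prime. *)
Lemma generated_splits : splits A d.
Proof.
have noethA := generated_noetherian noethR inj_iota domA alg_ys gen_ys.
apply: (idempotent_unimodular noethR noethA inj_iota domA dimR s0_neq0 zz' den) => s s0'.
move=> c Q cQ.
have [|||c1 c1P] := chain_over_cons (J' := fun a => a = 0) cQ (zero_prime domA).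
- by [].
- by move=> x ->; apply: ideal0; apply: adjoin_ideal; apply: zero_ideal.
- exists (iota s%:P); split; first by apply: adjoinr; apply: zero_ideal.
  by move=> /eqP; rewrite -(rmorph0 iota) (inj_eq inj_iota) polyC_eq0 (negPf s0').
have [c2 [pc2 _ _]] := generated_chain noethR inj_iota domA alg_ys gen_ys c1P.
exact: dimR pc2.
Qed.

End Generated.

(** * Rees algebras *)

Section Rees.
Variables (R : idomainType) (d : nat) (I : R -> Prop).
Hypotheses (noethR : noetherian R) (iI : is_ideal I).
Hypothesis dimR : forall c, ~ prime_chain (R := R) d.+1 c.

Lemma poly_splits : splits {poly R} d.
Proof.
apply: (@generated_splits R d {poly R} idfun noethR _ _ dimR [::] _ _ 1 1 1) => //.
- move=> x y /eqP; rewrite mulf_eq0 => /orP[] /eqP; by [left|right].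
- by rewrite oner_eq0.
- by rewrite /= mul1r polyC1.
- by move=> x; exists 0%N, x; rewrite rmorph1 mul1r.
Qed.

Variables (A : comNzRingType) (f : {rmorphism A -> {poly R}}).
Hypotheses (injf : injective f) (imf : forall p, rees_set I p <-> exists a, f a = p).

Lemma im_const r : exists a, f a = r%:P.
Proof.
by apply/imf => -[|i] //; rewrite coefC; exact: ideal0 (ipow_ideal iI _).
Qed.

Lemma im_linear x : I x -> exists a, f a = x%:P * 'X.
Proof.
move=> Ix; apply/imf => i; rewrite coefCM coefX.
case: eqP => [->|_]; first by rewrite mulr1; apply: ipow1.
by rewrite mulr0; apply: ideal0; apply: ipow_ideal.
Qed.

(** Now f identifies A with R. The matrices are extended to R[X], where [poly_splits] applies, and
    theta, which evaluates at 0, brings x and y back. Independence over R[X] is checked one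
    coefficient at a time. *)
Lemma rees_splits_zero : (forall x, I x -> x = 0) -> splits A d.
Proof.
move=> I0 n E V EE VE Vfree.
have fC a : f a = ((f a).[0])%:P.
  have : rees_set I (f a) by apply/imf; exists a.
  rewrite horner_coef0 => fa; apply/polyP => -[|i]; rewrite coefC //=.
  exact: ipow_zero I0 (fa i.+1).
have [|theta thetaE] := @factor_rmorphism A {poly R} {poly R} f (polyC \o horner_eval 0) injf.
  by move=> p; apply: im_const.
have thetaf a : theta (f a) = a.
  by apply: injf; rewrite thetaE /= horner_evalE -fC.
have [||c cV|x [y xy]] := poly_splits (E := map_mx f E) (V := map_mx f V).
- by rewrite -map_mxM EE.
- by rewrite -map_mxM VE.
- apply/rowP => j; rewrite mxE; apply/polyP => k; rewrite coef0.
  pose a : 'rV[A]_d.+1 := \row_j theta ((c 0 j)`_k)%:P.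
  have aV : a *m V = 0.
    apply/matrixP => i l; apply: injf; rewrite ord1 !mxE rmorph0 rmorph_sum.
    move/matrixP: cV => /(_ 0 l); rewrite !mxE => /(congr1 (fun p : {poly R} => (p`_k)%:P)).
    rewrite coef0 coef_sum rmorph_sum; apply: etrans; apply: eq_bigr => j' _.
    by rewrite rmorphM !mxE thetaE /= horner_evalE hornerC (fC (V j' l)) coefMC polyCM.
  have /rowP/(_ j) := Vfree a aV; rewrite !mxE => /(congr1 f).
  by rewrite thetaE rmorph0 /= horner_evalE hornerC => /eqP; rewrite polyC_eq0 => /eqP.
exists (map_mx theta x), (map_mx theta y).
have -> : E = map_mx theta (map_mx f E) by apply/matrixP => i j; rewrite !mxE thetaf.
by rewrite -!map_mxM mxE xy rmorph1.
Qed.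

Lemma rees_splits : splits A d.
Proof.
have [I0|/existsNP[a /not_implyP[Ia /eqP a0]]] := pselect (forall x, I x -> x = 0).
  exact: rees_splits_zero.
have domA := injective_domain injf.
have aX0 : a%:P * 'X != 0 :> {poly R} by rewrite mulf_neq0 ?polyX_eq0 // polyC_eq0.
(* The variable of R[v] goes to v = a X, with a a nonzero element of I. *)
have [|iota iotaE] := @factor_rmorphism A {poly R} {poly R} f
    (horner_eval (a%:P * 'X) \o map_poly polyC) injf.
  elim/poly_ind => [|p c [b bE]]; first by exists 0; rewrite !rmorph0.
  have [[u uE] [r rE]] := (im_linear Ia, im_const c).
  exists (b * u + r); rewrite rmorphD rmorphM bE uE rE rmorphD rmorphM /=.
  by rewrite map_polyX map_polyC !horner_evalE hornerX hornerC.
have {}iotaE p : f (iota p) = p \Po (a%:P * 'X) by rewrite iotaE.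
have inj_iota : injective iota.
  move=> p q /eqP; rewrite -subr_eq0 -rmorphB => /eqP/(congr1 f).
  rewrite iotaE rmorph0 => /eqP; rewrite comp_poly_eq0; first by rewrite subr_eq0 => /eqP.
  by rewrite size_Cmul // size_polyX.
have [l [lI lgen]] := noetherian_fg noethR iI.
pose y (x : R) := if pselect (I x) is left Ix then sval (cid (im_linear Ix)) else 0.
have yE x : I x -> f (y x) = x%:P * 'X.
  by move=> Ix; rewrite /y; case: pselect => // Ix'; apply: svalP (cid (im_linear Ix')).
apply: (@generated_splits R d A iota noethR inj_iota domA dimR (map y l) _ _ a%:P 1 a) => //.
- move=> _ /mapP[x xl ->]; exists a%:P, (x%:P * 'X); rewrite polyC_eq0; split=> //.
  apply: injf; rewrite rmorphM !iotaE yE; last exact: lI.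
  by rewrite comp_polyM !comp_polyC comp_polyX; ring.
- move=> B h hp hy b.
  pose S p := exists u, f (h u) = p.
  have SD p q : S p -> S q -> S (p + q).
    by move=> [u <-] [v <-]; exists (u + v); rewrite !rmorphD.
  have SM p q : S p -> S q -> S (p * q).
    by move=> [u <-] [v <-]; exists (u * v); rewrite !rmorphM.
  have SC r : S r%:P by have [u uE] := hp r%:P; exists u; rewrite uE iotaE comp_polyC.
  have SX x : I x -> S (x%:P * 'X).
    apply: (lgen (fun x => S (x%:P * 'X))) => [|u ul].
      split=> [|u v Su Sv|r u Su]; first by rewrite polyC0 mul0r -polyC0.
        by rewrite polyCD mulrDl; apply: SD.
      by rewrite polyCM -mulrA; apply: SM.
    have [|v vE] := hy (y u); first exact: map_f.
    by exists v; rewrite vE yE //; apply: lI.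
  suff [u /injf] : S (f b) by exists u.
  have Sk := ipow_generated (S := S) (SC 0) (SC 1) SD SM SC SX.
  have fb : rees_set I (f b) by apply/imf; exists b.
  rewrite -[f b]coefK poly_def; apply: (big_ind S) => // [|i _]; first by rewrite -polyC0.
  by rewrite -mul_polyC; apply: Sk.
- by rewrite mul1r.
(* a^m b_i X^i = b_i a^(m - i) (a X)^i for i <= m. *)
move=> b; pose m := size (f b); exists m, (\poly_(i < m) ((f b)`_i * a ^+ (m - i))).
apply: injf; rewrite rmorphM !iotaE -polyC_exp comp_polyC.
rewrite -{1}[f b]coefK !poly_def -/m rmorph_sum mulr_sumr; apply: eq_bigr => i _.
rewrite /= comp_polyZ comp_Xn_poly exprMn -polyC_exp -!mul_polyC polyCM.
by rewrite -{1}(subnK (ltnW (ltn_ord i))) exprD polyCM; ring.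
Qed.

End Rees.

Lemma divfX (F : fieldType) (x : F) m n : x != 0 -> (m <= n)%N ->
  x ^+ m / x ^+ n = x^-1 ^+ (n - m).
Proof.
move=> x0 /subnK => {1}<-; rewrite exprD invfM mulrCA mulfV ?mulr1 ?exprVn //.
by rewrite expf_neq0.
Qed.

(** * The extended Rees algebra, over R[v] with v = 1/t *)

Section ExtendedRees.
Variables (R : idomainType) (d : nat) (I : R -> Prop).
Hypotheses (noethR : noetherian R) (iI : is_ideal I).
Hypothesis dimR : forall c, ~ prime_chain (R := R) d.+1 c.
Variables (A : comNzRingType) (f : {rmorphism A -> {fraction {poly R}}}).
Hypotheses (injf : injective f) (imf : forall x, ext_rees_set I x <-> exists a, f a = x).

Local Notation tofrac := (@FracField.tofrac {poly R}).
Local Notation t := (tofrac 'X).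

Let t_neq0 : t != 0. Proof. by rewrite tofrac_eq0 polyX_eq0. Qed.

Definition eval_inv : {poly R} -> {fraction {poly R}} :=
  horner_eval t^-1 \o map_poly (tofrac \o polyC).

HB.instance Definition _ := GRing.RMorphism.on eval_inv.

Lemma eval_invC c : eval_inv c%:P = tofrac c%:P.
Proof. by rewrite /eval_inv /= map_polyC horner_evalE hornerC. Qed.

Lemma eval_invX : eval_inv 'X = t^-1.
Proof. by rewrite /eval_inv /= map_polyX horner_evalE hornerX. Qed.

Lemma poly_coefK n (p : {poly R}) : (size p <= n)%N -> \poly_(i < n) p`_i = p.
Proof.
move=> sp; apply/polyP => i; rewrite coef_poly; case: ltnP => // leni.
by rewrite nth_default // (leq_trans sp).
Qed.

Lemma rev_poly_coef n (p : {poly R}) i : (i <= n)%N ->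
  (\poly_(i < n.+1) p`_(n - i))`_(n - i) = p`_i.
Proof. by move=> lein; rewrite coef_poly ltnS leq_subr subKn. Qed.

(** Rewriting p / t^n in powers of 1/t reverses the coefficients. This yields the injectivity of
    [eval_inv] and the denominators of elements of A. *)
Lemma eval_inv_rev n (p : {poly R}) : (size p <= n.+1)%N ->
  tofrac p / tofrac ('X^n) = eval_inv (\poly_(i < n.+1) p`_(n - i)).
Proof.
move=> sp; rewrite -{1}(poly_coefK sp) !poly_def !rmorph_sum mulr_suml.
rewrite (reindex_inj rev_ord_inj); apply: eq_bigr => i _; rewrite /= subSS.
have lein : (i <= n)%N by rewrite -ltnS.
rewrite -!mul_polyC !rmorphM /= eval_invC !rmorphXn /= eval_invX -mulrA; congr (_ * _).
by rewrite divfX ?leq_subr // subKn.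
Qed.

Lemma eval_inv_inj : injective eval_inv.
Proof.
move=> p q /eqP; rewrite -subr_eq0 -rmorphB => /eqP.
suff ker0 (g : {poly R}) : eval_inv g = 0 -> g = 0 by move=> /ker0/eqP; rewrite subr_eq0 => /eqP.
move=> g0; pose n := size g; pose h := \poly_(i < n.+1) g`_(n - i).
have := @eval_inv_rev n h (size_poly _ _).
have -> : \poly_(i < n.+1) h`_(n - i) = g.
  rewrite -[RHS](poly_coefK (leqnSn n)); apply/polyP => i; rewrite [LHS]coef_poly [RHS]coef_poly.
  by case: ltnP => // lein; exact: rev_poly_coef.
rewrite g0 => /eqP; rewrite mulf_eq0 invr_eq0 !tofrac_eq0 (negPf (monic_neq0 (monicXn _ n))) orbF => /eqP h0.
apply/polyP => i; rewrite coef0; have [lein|ltni] := leqP i n.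
  by rewrite -(rev_poly_coef g lein) -/h h0 coef0.
by rewrite nth_default // ltnW.
Qed.

Lemma ext_im_poly (p : {poly R}) : rees_set I p -> exists a, f a = tofrac p.
Proof.
move=> Ip; apply/imf; exists 0%N, p; rewrite expr0 tofrac1 divr1; split=> // i.
by rewrite subn0; apply: Ip.
Qed.

Lemma ext_splits : splits A d.
Proof.
have domA := injective_domain injf.
have im_const r : exists a, f a = tofrac r%:P.
  by apply: ext_im_poly => -[|i] //; rewrite coefC; exact: ideal0 (ipow_ideal iI _).
have im_linear x : I x -> exists a, f a = tofrac (x%:P * 'X).
  move=> Ix; apply: ext_im_poly => i; rewrite coefCM coefX.
  case: eqP => [->|_]; first by rewrite mulr1; apply: ipow1.
  by rewrite mulr0; apply: ideal0; apply: ipow_ideal.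
have [v vE] : exists a, f a = t^-1.
  apply/imf; exists 1%N, 1; rewrite expr1 tofrac1 div1r; split=> // -[|i] //.
  by rewrite coefC; exact: ideal0 (ipow_ideal iI _).
have [|iota iotaE] := @factor_rmorphism A {poly R} {fraction {poly R}} f eval_inv injf.
  elim/poly_ind => [|p c [b bE]]; first by exists 0; rewrite !rmorph0.
  have [r rE] := im_const c.
  exists (b * v + r); rewrite rmorphD rmorphM bE vE rE.
  by rewrite [RHS]rmorphD rmorphM /= eval_invC eval_invX.
have {}iotaE p : f (iota p) = eval_inv p by exact: iotaE.
have inj_iota : injective iota.
  by move=> p q /(congr1 f); rewrite !iotaE => /eval_inv_inj.
have [l [lI lgen]] := noetherian_fg noethR iI.
pose y (x : R) := if pselect (I x) is left Ix then sval (cid (im_linear x Ix)) else 0.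
have yE x : I x -> f (y x) = tofrac (x%:P * 'X).
  by move=> Ix; rewrite /y; case: pselect => // Ix'; apply: svalP (cid (im_linear x Ix')).
have alg w : w \in map y l -> exists b c, b != 0 /\ iota b * w = iota c.
  move=> /mapP[x xl ->]; exists 'X, x%:P; rewrite polyX_eq0; split=> //.
  apply: injf; rewrite rmorphM !iotaE yE; last exact: lI.
  by rewrite eval_invX eval_invC rmorphM mulrCA mulVf ?mulr1.
have gen (B : idomainType) (h : {rmorphism B -> A}) :
    (forall p, exists b, h b = iota p) -> (forall w, w \in map y l -> exists b, h b = w) ->
    forall a, exists b, h b = a.
  move=> hp hy b.
  pose S p := exists u, f (h u) = tofrac p.
  have SD p q : S p -> S q -> S (p + q).
    by move=> [u uE] [w wE]; exists (u + w); rewrite !rmorphD uE wE.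
  have SM p q : S p -> S q -> S (p * q).
    by move=> [u uE] [w wE]; exists (u * w); rewrite !rmorphM uE wE.
  have SC r : S r%:P by have [u uE] := hp r%:P; exists u; rewrite uE iotaE eval_invC.
  have SX x : I x -> S (x%:P * 'X).
    apply: (lgen (fun x => S (x%:P * 'X))) => [|u ul].
      split=> [|u w Su Sw|r u Su]; first by rewrite polyC0 mul0r -polyC0.
        by rewrite polyCD mulrDl; apply: SD.
      by rewrite polyCM -mulrA; apply: SM.
    have [|w wE] := hy (y u); first exact: map_f.
    by exists w; rewrite wE yE //; apply: lI.
  have Sk := ipow_generated (S := S) (SC 0) (SC 1) SD SM SC SX.
  suff [u /injf] : exists u, f (h u) = f b by exists u.
  have [n [p [-> Ip]]] : ext_rees_set I (f b) by apply/imf; exists b.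
  rewrite -[p]coefK poly_def rmorph_sum mulr_suml.
  apply: (big_ind (fun x => exists u, f (h u) = x)); first by exists 0; rewrite !rmorph0.
    by move=> _ _ [u <-] [w <-]; exists (u + w); rewrite !rmorphD.
  (* Degree i - n >= 0 is reached by products of elements of It, negative degree by powers of
     1/t. *)
  move=> i _; rewrite -mul_polyC; have [leni|ltin] := leqP n i.
    have [u uE] := Sk _ _ (Ip i); exists u; rewrite uE.
    have -> : 'X^i = 'X^(i - n) * 'X^n :> {poly R} by rewrite -exprD subnK.
    rewrite mulrA.
    have tn : tofrac 'X^n != 0 by rewrite tofracXn expf_neq0.
    by rewrite /= [in RHS]tofracM (mulfK tn).
  have [[u uE] [w wE]] := (SC p`_i, hp 'X); exists (u * w ^+ (n - i)).
  rewrite !rmorphM !rmorphXn uE wE iotaE eval_invX /= -mulrA; congr (_ * _).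
  by rewrite divfX // ltnW.
have [I0|/existsNP[a /not_implyP[Ia /eqP a0]]] := pselect (forall x, I x -> x = 0).
  (* With I = 0 the algebra is R[v] itself, and nothing has to be inverted. *)
  apply: (generated_splits noethR inj_iota domA dimR alg gen
    (z' := 1) (z := 1) (s0 := 1)) => [||b]; first by rewrite oner_eq0.
    by rewrite mul1r polyC1.
  have [n [p [bE Ip]]] : ext_rees_set I (f b) by apply/imf; exists b.
  exists 0%N, (\poly_(i < n.+1) p`_(n - i)); apply: injf.
  rewrite expr0 rmorphM rmorph1 rmorph1 mul1r bE iotaE eval_inv_rev //.
  apply/leq_sizeP => i ltni; apply: (ipow_zero I0 (k := (i - n).-1)).
  by rewrite prednK ?subn_gt0.
(* (a t) v = a, so inverting a makes v invertible. *)
have [z zE] := im_linear a Ia.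
apply: (generated_splits noethR inj_iota domA dimR alg gen (z' := 'X) (z := z) a0) => [|b].
  by apply: injf; rewrite rmorphM !iotaE zE eval_invX eval_invC rmorphM mulfK.
have [n [p [bE _]]] : ext_rees_set I (f b) by apply/imf; exists b.
(* v^m (p / t^n) = p / t^(m + n), a polynomial in v because p has degree at most m + n. *)
pose m := size p; exists m, (\poly_(i < (m + n).+1) p`_(m + n - i)); apply: injf.
rewrite rmorphM bE !iotaE -eval_inv_rev; last by rewrite -addnS leq_addr.
by rewrite rmorphXn /= eval_invX exprD rmorphM invfM mulrCA exprVn -rmorphXn.
Qed.

End ExtendedRees.

Theorem theorem3p5 (R : idomainType) (d : nat) (I : R -> Prop) :
  noetherian R -> krull_dim R d -> is_ideal I ->
  (forall (A : comNzRingType) (f : {rmorphism A -> {poly R}}),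
     injective f -> (forall p, rees_set I p <-> exists a, f a = p) ->
     forall P : lmodType A, fg_projective P -> rank_gt P d ->
     exists p : P, unimodular p) /\
  (forall (A : comNzRingType) (f : {rmorphism A -> {fraction {poly R}}}),
     injective f -> (forall x, ext_rees_set I x <-> exists a, f a = x) ->
     forall Q : lmodType A, fg_projective Q -> rank_gt Q d ->
     exists q : Q, unimodular q).
Proof.
move=> noethR [_ dimR] iI; have {}dimR c : ~ prime_chain (R := R) d.+1 c.
  by move=> pc; apply: dimR; exists c.
split=> A f injf imf; apply: splits_unimodular.
  exact: rees_splits noethR iI dimR _ _ injf imf.
exact: ext_splits noethR iI dimR _ _ injf imf.
Qed.
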